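(* Let $\Gamma$ be a countable amenable group and let $\pi\colon X\to Y$ be a factor map between dynamical systems $\Gamma\curvearrowright X$ and $\Gamma\curvearrowright Y$. Then $$\operatorname{mdim}(X)\le \operatorname{mdim}(Y)+\operatorname{mdim}(X|Y).$$
   Context: $\Gamma$ is a countable amenable group and $\mathcal F(\Gamma)$ is the set of nonempty finite subsets of $\Gamma$. For $K\in\mathcal F(\Gamma)$ and $\delta>0$, $\mathcal B(K,\delta)$ is the set of $F\in\mathcal F(\Gamma)$ with $|\{t\in F: Kt\subseteq F\}|\ge(1-\delta)|F|$. For a real-valued $\varphi$ on $\mathcal F(\Gamma)$, $\lim_F\varphi(F)=c$ means: for every $\varepsilon>0$ there are $K\in\mathcal F(\Gamma)$, $\delta>0$ with $|\varphi(F)-c|<\varepsilon$ for all $F\in\mathcal B(K,\delta)$. A dynamical system $\Gamma\curvearrowright X$ is a (nonempty) compact metrizable space $X$ with a continuous action of $\Gamma$. A factor map $\pi\colon X\to Y$ is a continuous $\Gamma$-equivariant surjection. For a finite open cover $\mathcal U$ of $X$, $\operatorname{ord}(\mathcal U)=\max_{x\in X}\sum_{U\in\mathcal U}1_U(x)-1$. For families of sets, $\mathcal U\vee\mathcal V=\{U\cap V:U\in\mathcal U,V\in\mathcal V\}$, and $\mathcal U$ refines $\mathcal V$ if every element of $\mathcal U$ is contained in some element of $\mathcal V$. For $F\in\mathcal F(\Gamma)$, $\mathcal U^F=\bigvee_{s\in F}s^{-1}\mathcal U$. $\mathcal D(\mathcal U|Y)$ is the minimum of $\operatorname{ord}(\mathcal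 W)$ over all finite open covers $\mathcal W$ of $X$ such that $\{\pi^{-1}(y)\}_{y\in Y}\vee\mathcal W$ refines $\mathcal U$. The limit $\lim_F\mathcal D(\mathcal U^F|Y)/|F|$ exists. The conditional mean dimension is $$\operatorname{mdim}(X|Y)=\sup_{\mathcal U}\lim_F\frac{\mathcal D(\mathcal U^F|Y)}{|F|}\in[0,\infty],$$ with $\mathcal U$ ranging over all finite open covers of $X$. The mean dimension $\operatorname{mdim}(X)$ is the case when $Y$ is a singleton; i.e. $\operatorname{mdim}(X)=\sup_{\mathcal U}\lim_F\mathcal D(\mathcal U^F)/|F|$, where $\mathcal D(\mathcal U)$ is the minimum of $\operatorname{ord}(\mathcal W)$ over finite open covers $\mathcal W$ of $X$ refining $\mathcal U$. Similarly for $\operatorname{mdim}(Y)$. *)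

(* Defs.v *)
From HB Require Import structures.
From mathcomp Require Import all_boot all_order all_algebra finmap.
From mathcomp Require Import all_classical all_reals all_analysis.
Set Implicit Arguments.
Unset Strict Implicit.
Unset Printing Implicit Defensive.
Import Order.TTheory GRing.Theory Num.Theory.
Import numFieldNormedType.Exports.
Local Open Scope classical_set_scope.
Local Open Scope ring_scope.

Definition left_translate (G : groupType) (K : {fset G}) (t : G) : {fset G} :=
  [fset (k * t)%g | k in K]%fset.

Definition folner_set (R : realType) (G : groupType) (K : {fset G}) (delta : R) :
    set {fset G} :=
  [set F | F != fset0 /\
     (1 - delta) * (#|` F|%fset)%:R <=
       (#|` [fset t in F | (left_translate K t `<=` F)%fset]%fset |%fset)%:R].

Definition amenable (R : realType) (G : groupType) : Prop :=
  forall (K : {fset G}) (delta : R), K != fset0 -> 0 < delta ->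
    folner_set K delta !=set0.

(* [phi F @[F --> folner_filter R G] --> c] is the statement lim_F phi(F) = c. *)
Definition folner_filter (R : realType) (G : groupType) : set_system {fset G} :=
  filter_from [set Kd : {fset G} * R | Kd.1 != fset0 /\ 0 < Kd.2]
    (fun Kd => folner_set Kd.1 Kd.2).
Arguments folner_filter R G : clear implicits.

Definition metrizable (R : realType) (X : topologicalType) : Prop :=
  exists d : X -> X -> R,
    [/\ forall x y, d x y = 0 <-> x = y,
        forall x y, d x y = d y x,
        forall x y z, d x z <= d x y + d y z
      & forall (x : X) (A : set X),
          nbhs x A <-> exists2 e, 0 < e & [set y | d x y < e] `<=` A].

Record dynamical_system (R : realType) (G : groupType) (X : topologicalType)
    (act : G -> X -> X) : Prop := DynamicalSystem {
  dynsys_nonempty : [set: X] !=set0;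
  dynsys_compact : compact [set: X];
  dynsys_metrizable : metrizable R X;
  dynsys_act1 : forall x, act 1%g x = x;
  dynsys_actM : forall g h x, act (g * h)%g x = act g (act h x);
  dynsys_continuous : forall g, continuous (act g) }.

Record factor_map (G : groupType) (X Y : topologicalType)
    (actX : G -> X -> X) (actY : G -> Y -> Y) (pi : X -> Y) : Prop := FactorMap {
  factor_continuous : continuous pi;
  factor_equivariant : forall g x, pi (actX g x) = actY g (pi x);
  factor_surjective : set_surj [set: X] [set: Y] pi }.

Record finite_open_cover (X : topologicalType) (U : set (set X)) : Prop :=
  FiniteOpenCover {
  cover_finite : finite_set U;
  cover_open : U `<=` open;
  cover_total : \bigcup_(A in U) A = [set: X] }.

(* The supremum is a maximum when U is finite and X is nonempty. *)
Definition ord_cover (R : realType) (X : Type) (U : set (set X)) : R :=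
  sup [set \sum_(A \in U) (\1_A x : R) | x in [set: X]] - 1.

Definition join_fam (X : Type) (U V : set (set X)) : set (set X) :=
  [set A `&` B | A in U & B in V].

Definition refines (X : Type) (U V : set (set X)) : Prop :=
  forall A, U A -> exists2 B, V B & A `<=` B.

(* [join_fam] is associative and commutative with unit [[set setT]]. *)
Definition iter_cover (G : groupType) (X : Type) (act : G -> X -> X)
    (U : set (set X)) (F : {fset G}) : set (set X) :=
  \big[@join_fam X/[set [set: X]]]_(s <- F) [set act s^-1%g @` A | A in U].

Definition fibers (X Y : Type) (pi : X -> Y) : set (set X) :=
  [set pi @^-1` [set y] | y in [set: Y]].

(* The orders of finite covers of a nonempty space are natural numbers, so the
   infima in [dim_cover] and [dim_cover_rel] are minima. *)
Definition dim_cover (R : realType) (X : topologicalType) (U : set (set X)) : R :=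
  inf [set ord_cover R W | W in
        [set W | finite_open_cover W /\ refines W U]].

Definition dim_cover_rel (R : realType) (X : topologicalType) (Y : Type)
    (pi : X -> Y) (U : set (set X)) : R :=
  inf [set ord_cover R W | W in
        [set W | finite_open_cover W /\ refines (join_fam (fibers pi) W) U]].

Definition mdim (R : realType) (G : groupType) (X : topologicalType)
    (act : G -> X -> X) : \bar R :=
  ereal_sup [set (lim (dim_cover R (iter_cover act U F) / (#|` F|%fset)%:R
                       @[F --> folner_filter R G]))%:E
            | U in @finite_open_cover X].

Definition mdim_rel (R : realType) (G : groupType) (X : topologicalType)
    (Y : Type) (act : G -> X -> X) (pi : X -> Y) : \bar R :=
  ereal_sup [set (lim (dim_cover_rel R pi (iter_cover act U F) / (#|` F|%fset)%:R
                       @[F --> folner_filter R G]))%:E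
            | U in @finite_open_cover X].

(* Main.v *)
(* For a finite open cover U of X, the orders D(U^F) and D(U^F|Y) are monotone,
   subadditive and right invariant in F, so quasi-tiling a large Folner set by
   smaller ones gives the limits (Ornstein-Weiss). Choose tiles T with
   D(U^T|Y) / |T| close to its limit, and covers W_T of X of order D(U^T|Y)
   whose traces on the fibers refine U^T. By compactness, after shrinking W_T
   there is a cover V_T of Y such that W_T and the pullback of V_T together
   refine U^T. If F is quasi-tiled by translates T c, then the pullback of V^F,
   with V the join of the V_T, together with the translates of the W_T and a few
   translates of U refines U^F. Since orders are subadditive under joins, D(U^F)
   is at most D(V^F) + (sum of the orders of the W_T) + o(|F|). *)

Require Import Defs.
From HB Require Import structures.
From mathcomp Require Import all_boot all_order all_algebra finmap.
From mathcomp Require Import all_classical all_reals all_analysis.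
From mathcomp Require Import ring lra.
Set Implicit Arguments.
Unset Strict Implicit.
Unset Printing Implicit Defensive.
Import Order.TTheory GRing.Theory Num.Theory.
Import numFieldNormedType.Exports.
Local Open Scope classical_set_scope.
Local Open Scope ring_scope.

(** * Orders of finite covers *)

(** Intersecting the members of two covers of orders m and n can produce order (m+1)(n+1)-1, so
    subadditivity needs a cover finer than the join. It is built from continuous functions positive
    on the members, which is where metrizability enters; they need not be normalized to partitions
    of unity. Shrinking the W_T is what makes V_T open: the points over y at which the refinement
    fails must form a closed set, so open members give way to closed superlevel sets of those
    functions. The order of the choices matters. The tile shapes form a finite list fixed before F,
    so V is a single cover and D(V^F)/|F| has a limit to compare with. The centers c are taken in F,
    so that V^F refines each translate of V by c. *)

Lemma sum_indic_count (R : realType) (X : Type) (W : set (set X)) (x : X) :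
  finite_set W ->
  \sum_(A \in W) (\1_A x : R) = (count (fun A : set X => x \in A) (fset_set W))%:R.
Proof.
move=> fW; rewrite fsbig_finite //= -sum1_count [in RHS]big_mkcond natr_sum /=.
by apply: eq_bigr => A _; rewrite indicE; case: ifP.
Qed.

Lemma ord_cover_le (R : realType) (X : Type) (W : set (set X)) (n : nat) :
  [set: X] !=set0 -> finite_set W ->
  (forall x, (count (fun A : set X => x \in A) (fset_set W) <= n.+1)%N) ->
  ord_cover R W <= n%:R.
Proof.
move=> [x0 _] fW cW; rewrite /ord_cover lerBlDr natr1.
apply: ge_sup; first by exists (\sum_(A \in W) (\1_A x0 : R)), x0.
by move=> _ [x _ <-]; rewrite sum_indic_count // ler_nat.
Qed.

(** Counts are bounded by the number of members, so a maximal count k exists; totality of the cover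
    makes k positive, and the order is k-1. Orders are handled through counts at points from here
    on. *)
Lemma ord_cover_nat (R : realType) (X : topologicalType) (W : set (set X)) :
  [set: X] !=set0 -> finite_open_cover W ->
  exists2 n : nat, ord_cover R W = n%:R &
    forall x, (count (fun A : set X => x \in A) (fset_set W) <= n.+1)%N.
Proof.
move=> [x0 _] [fW _ cW].
pose c x := count (fun A : set X => x \in A) (fset_set W).
have exk : exists k, `[< exists x, c x = k >].
  by exists (c x0); apply/asboolP; exists x0.
have ubk k : `[< exists x, c x = k >] -> (k <= size (fset_set W))%N.
  by move=> /asboolP[x <-]; rewrite /c count_size.
case: (ex_maxnP exk ubk) => k /asboolP[x xk] kmax.
have ck y : (c y <= k)%N by apply: kmax; apply/asboolP; exists y.
have k0 : (0 < k)%N.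
  rewrite -xk -has_count; have : [set: X] x by [].
  rewrite -cW => -[A WA Ax]; apply/hasP; exists A; last exact: mem_set.
  by rewrite in_fset_set // mem_set.
exists k.-1; last by move=> y; rewrite prednK ?ck.
rewrite /ord_cover.
rewrite -subn1 natrB //; congr (_ - _).
apply/eqP; rewrite eq_le; apply/andP; split.
  apply: ge_sup; first by exists (\sum_(A \in W) (\1_A x0 : R)), x0.
  by move=> _ [y _ <-]; rewrite sum_indic_count // ler_nat; exact: ck.
apply: ub_le_sup; last by exists x => //; rewrite sum_indic_count // -/(c x) xk.
by exists k%:R => _ [y _ <-]; rewrite sum_indic_count // ler_nat; exact: ck.
Qed.

(** Distinct indices may give the same set, so passing from an indexed family to its set of values
    can only lower multiplicities. Orders can therefore be bounded by counting indices. *)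
Lemma count_fset_set_image (X : Type) (I : eqType) (s : seq I) (f : I -> set X)
    (x : X) :
  (count (fun A : set X => x \in A) (fset_set [set f i | i in [set` s]])
   <= count (fun i => x \in f i) s)%N.
Proof.
have fin : finite_set [set f i | i in [set` s]].
  exact: finite_image.
rewrite -[leqRHS](count_map f (fun A : set X => x \in A)).
rewrite -!size_filter; apply: uniq_leq_size; first exact/filter_uniq/fset_uniq.
move=> A; rewrite !mem_filter => /andP[->]; rewrite in_fset_set // inE.
by case=> i /= si <-; exact: map_f.
Qed.

Lemma finite_open_cover_image (X : topologicalType) (I : eqType) (s : seq I)
    (f : I -> set X) :
  (forall i, i \in s -> open (f i)) -> (forall x, exists2 i, i \in s & f i x) ->
  finite_open_cover [set f i | i in [set` s]].
Proof.
move=> fo fc; split; first exact: finite_image.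
  by move=> _ [i si <-]; exact: fo.
apply/seteqP; split => // x _; have [i si fix_] := fc x.
by exists (f i) => //; exists i.
Qed.

Lemma ord_cover_image_le (R : realType) (X : topologicalType) (I : eqType)
    (s : seq I) (f : I -> set X) (n : nat) :
  [set: X] !=set0 ->
  (forall x, (count (fun i => x \in f i) s <= n.+1)%N) ->
  ord_cover R [set f i | i in [set` s]] <= n%:R.
Proof.
move=> X0 fn; apply: ord_cover_le => // [|x]; first exact: finite_image.
exact: leq_trans (count_fset_set_image s f x) (fn x).
Qed.

(** * Order of a join *)

(** The distance to the complement of [A] works: it is 1-Lipschitz, and openness makes it positive
    on [A]. *)
Lemma continuous_dist_fun (R : realType) (X : topologicalType) (A : set X) :
  metrizable R X -> open A ->
  exists f : X -> R, [/\ continuous f, forall x, 0 <= f x &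
    forall x, 0 < f x <-> A x].
Proof.
move=> [d [d0 dC dT dN]] oA.
have dge0 x y : 0 <= d x y.
  by have := dT x y x; rewrite (dC y x) (proj2 (d0 x x)) // => ?; lra.
(* With an empty complement the infimum of distances would be the default 0, so the constant 1 is
   used instead. *)
have [AT|/existsNP[z0 Az0]] := pselect (forall x, A x).
  exists (fun=> 1); split; [by move=> x; exact: cvg_cst|by move=> x|].
  by move=> x; split.
pose f x := inf [set d x z | z in ~` A].
have S0 x : [set d x z | z in ~` A] !=set0 by exists (d x z0), z0.
have lbS x : has_lbound [set d x z | z in ~` A].
  by exists 0 => _ [z _ <-].
have f0 x : 0 <= f x by apply: lb_le_inf => // _ [z _ <-].
have fL x y : f x <= d x y + f y.
  rewrite -lerBlDl; apply: lb_le_inf => // _ [z Az <-].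
  rewrite lerBlDl; apply: le_trans (dT x y z).
  by apply: ge_inf => //; exists z.
exists f; split => //.
  move=> x; apply/cvgrPdist_lt => e e0.
  have : nbhs x [set y | d x y < e] by apply/dN; exists e.
  apply: filterS => y /= dxy; have := fL x y; have := fL y x.
  by rewrite (dC y x) ltr_norml => ? ?; lra.
move=> x; split => [fx|Ax].
  apply: contrapT => nAx; move: fx; rewrite ltNge => /negP; apply.
  by apply: ge_inf => //; exists x => //; exact/d0.
have : nbhs x A by exact: open_nbhs_nbhs.
move=> /dN[e e0 eA]; apply: lt_le_trans e0 _.
apply: lb_le_inf => // _ [z Az <-]; rewrite leNgt; apply/negP => dxz.
exact/Az/eA.
Qed.

(** * Overlapping cells of two systems of partial sums *)

Definition psum (R : realType) (a : nat -> R) (i : nat) : R := \sum_(0 <= k < i) a k.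

(** The four inequalities say that the open intervals between consecutive partial sums, the [i]-th
    of [a] and the [j]-th of [b], meet: the larger left end lies below the smaller right end.
    Strictness makes this an open condition when [a] and [b] depend continuously on a point. *)
Definition overlap (R : realType) (a b : nat -> R) (ij : nat * nat) : bool :=
  [&& psum a ij.1 < psum a ij.1.+1, psum a ij.1 < psum b ij.2.+1,
      psum b ij.2 < psum a ij.1.+1 & psum b ij.2 < psum b ij.2.+1].

Lemma psumS (R : realType) (c : nat -> R) (i : nat) : psum c i.+1 = psum c i + c i.
Proof. by rewrite /psum big_nat_recr. Qed.

Lemma le_psum (R : realType) (c : nat -> R) (i j : nat) :
  (forall i, 0 <= c i) -> (i <= j)%N -> psum c i <= psum c j.
Proof.
move=> c0; apply: (@homo_leq _ _ (fun x y : R => x <= y)) => //.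
  by move=> ? ? ?; exact: le_trans.
by move=> k; rewrite psumS lerDl.
Qed.

Lemma overlap_gt0 (R : realType) (a b : nat -> R) (i j : nat) :
  overlap a b (i, j) -> 0 < a i /\ 0 < b j.
Proof. by rewrite /overlap !psumS /= => /and4P[+ _ _ +]; lra. Qed.

Lemma psum_pos_exists (R : realType) (c : nat -> R) (p : nat) :
  (forall i, 0 <= c i) -> 0 < psum c p ->
  exists i, [/\ (i < p)%N, psum c i = 0 & 0 < psum c i.+1].
Proof.
move=> c0; elim: p => [|p IH]; first by rewrite /psum big_geq // ltxx.
move=> cp; have [/IH[i [ip ? ?]]|] := ltP 0 (psum c p).
  by exists i; split => //; exact: ltnW.
move=> cp0; exists p; split => //; apply/eqP; rewrite eq_le cp0 /=.
by apply: sumr_ge0.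
Qed.

(** The first nonempty cells of [a] and of [b] both start at 0, hence overlap. This is why the two
    totals need not agree. *)
Lemma overlap_exists (R : realType) (a b : nat -> R) (p q : nat) :
  (forall i, 0 <= a i) -> (forall i, 0 <= b i) ->
  0 < psum a p -> 0 < psum b q ->
  exists i j, [/\ (i < p)%N, (j < q)%N & overlap a b (i, j)].
Proof.
move=> a_ge0 b_ge0.
move=> /(psum_pos_exists a_ge0)[i [ip ai0 ai1]].
move=> /(psum_pos_exists b_ge0)[j [jq bj0 bj1]].
by exists i, j; split => //; rewrite /overlap /= ai0 bj0 ai1 bj1.
Qed.

(* The partial sums of [a] and [b] cut the half-line into cells, and the pairs of
   overlapping cells form a chain for the product order. A chain in an
   (m+1) x (n+1) grid has at most m+n+1 elements: this is why orders add up. *)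
Lemma overlap_chain (R : realType) (a b : nat -> R) (i j i' j' : nat) :
  (forall i, 0 <= a i) -> (forall i, 0 <= b i) ->
  overlap a b (i, j) -> overlap a b (i', j') -> (i < i')%N -> (j <= j')%N.
Proof.
move=> a_ge0 b_ge0 /and4P[/= _ _ h _] /and4P[/= _ h' _ _] ii'; rewrite leqNgt.
apply/negP => jj'; have := le_psum a_ge0 ii'; have := le_psum b_ge0 jj'.
lra.
Qed.
(** Only the numbers of positive terms are bounded, not [p] and [q], so indices are replaced by
    ranks: the number of positive terms before them. The sum of the two ranks is injective on the
    chain of overlapping pairs. A positive term does not count itself, so the ranks are at most m
    and n and the sum takes at most m+n+1 values. *)
Lemma count_overlap (R : realType) (a b : nat -> R) (p q m n : nat) :
  (forall i, 0 <= a i) -> (forall i, 0 <= b i) ->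
  (count (fun k => (0 < a k)%R) (iota 0 p) <= m.+1)%N ->
  (count (fun k => (0 < b k)%R) (iota 0 q) <= n.+1)%N ->
  (count (overlap a b) [seq (i, j) | i <- iota 0 p, j <- iota 0 q]
     <= (m + n).+1)%N.
Proof.
move=> a0 b0 cm cn.
pose rank (c : nat -> R) i := count (fun k => 0 < c k) (iota 0 i).
have le_rank c i j : (i <= j)%N -> (rank c i <= rank c j)%N.
  by move=> /subnKC <-; rewrite /rank iotaD count_cat leq_addr.
have lt_rank c i j : (i < j)%N -> 0 < c i -> (rank c i < rank c j)%N.
  move=> ij ci; apply: leq_trans (le_rank _ _ _ ij).
  by rewrite /rank -[i.+1]addn1 iotaD count_cat /= ci addn0 addn1.
pose r ij := (rank a ij.1 + rank b ij.2)%N.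
set s := [seq (i, j) | i <- _, j <- _].
have us : uniq s by apply: allpairs_uniq; rewrite ?iota_uniq // => -[? ?] [? ?].
have rlt i j i' j' : overlap a b (i, j) -> overlap a b (i', j') ->
    (i < i')%N -> (r (i, j) < r (i', j'))%N.
  move=> ov ov1 ii'; have jj' := overlap_chain a0 b0 ov ov1 ii'.
  have [ai _] := overlap_gt0 ov.
  by rewrite /r -addSn; apply: leq_add; [exact: lt_rank|exact: le_rank].
rewrite -size_filter -(size_map r) -[leqRHS](size_iota 0).
apply: uniq_leq_size.
  rewrite map_inj_in_uniq ?filter_uniq // => -[i j] [i' j'].
  rewrite !mem_filter => /andP[ov _] /andP[ov1 _] er.
  have [ii'|ii'|ii'] := ltngtP i i'.
  - by have := rlt _ _ _ _ ov ov1 ii'; rewrite er ltnn.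
  - by have := rlt _ _ _ _ ov1 ov ii'; rewrite er ltnn.
  - move: er ov1; rewrite -ii' => er ov1; congr (_, _).
    have [_ bj] := overlap_gt0 ov; have [_ bj'] := overlap_gt0 ov1.
    move: er => /addnI /= er; have [jj'|jj'|//] := ltngtP j j'.
      by have := lt_rank b _ _ jj' bj; rewrite er ltnn.
    by have := lt_rank b _ _ jj' bj'; rewrite er ltnn.
move=> _ /mapP[[i j] + ->]; rewrite mem_filter mem_iota => /andP[ov].
move=> /allpairsP[[i1 j1] /= [+ + [ei ej]]]; rewrite -{}ei -{}ej !mem_iota /=.
rewrite !add0n => ip jq; have [ai bj] := overlap_gt0 ov.
rewrite ltnS leq_add // -ltnS.
  exact: leq_trans (lt_rank _ _ _ ip ai) cm.
exact: leq_trans (lt_rank _ _ _ jq bj) cn.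
Qed.

Lemma open_lt_fun (R : realType) (X : topologicalType) (f g : X -> R) :
  continuous f -> continuous g -> open [set x | f x < g x].
Proof.
move=> cf cg; have -> : [set x | f x < g x] = (g \- f) @^-1` [set y | 0 < y].
  by apply/seteqP; split => x /=; rewrite subr_gt0.
apply: open_comp; last exact: open_gt.
by move=> x _; apply: continuousB; [exact: cg|exact: cf].
Qed.

Lemma continuous_psum (R : realType) (X : topologicalType) (f : nat -> X -> R)
    (i : nat) :
  (forall k, continuous (f k)) -> continuous (fun x => psum (f ^~ x) i).
Proof.
move=> cf; elim: i => [|i IH] x.
  rewrite /psum (_ : (fun=> _) = fun=> 0); first exact: cvg_cst.
  by apply/funext => y; rewrite big_geq.
rewrite (_ : (fun=> _) = (fun x => psum (f ^~ x) i) \+ f i); last first.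
  by apply/funext => y; rewrite psumS.
by apply: continuousD; [exact: IH|exact: cf].
Qed.

Lemma open_overlap (R : realType) (X : topologicalType) (f g : nat -> X -> R)
    (ij : nat * nat) :
  (forall k, continuous (f k)) -> (forall k, continuous (g k)) ->
  open [set x | overlap (f ^~ x) (g ^~ x) ij].
Proof.
move=> cf cg; rewrite (_ : [set x | _] =
    ([set x | psum (f ^~ x) ij.1 < psum (f ^~ x) ij.1.+1] `&`
     [set x | psum (f ^~ x) ij.1 < psum (g ^~ x) ij.2.+1]) `&`
    ([set x | psum (g ^~ x) ij.2 < psum (f ^~ x) ij.1.+1] `&`
     [set x | psum (g ^~ x) ij.2 < psum (g ^~ x) ij.2.+1])).
  by do !apply: openI; apply: open_lt_fun; exact: continuous_psum.
by apply/seteqP; split => x /=; [move=> /and4P[]|move=> [[? ?] [? ?]]; exact/and4P].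
Qed.

(** Past the size of the cover the default [set0] forces [f i] to vanish, so sequences indexed by
    all naturals can serve. *)
Lemma cover_functions (R : realType) (X : topologicalType) (W : set (set X)) :
  metrizable R X -> finite_open_cover W ->
  exists f : nat -> X -> R, [/\ forall i, continuous (f i),
    forall i x, 0 <= f i x,
    forall i x, 0 < f i x -> nth set0 (fset_set W) i x &
    forall x, exists2 i, (i < size (fset_set W))%N & 0 < f i x].
Proof.
move=> mX [fW oW cW].
have os i : open (nth set0 (fset_set W) i).
  have [h|h] := ltnP i (size (fset_set W));
    last by rewrite nth_default //; exact: open0.
  apply: oW; have : nth set0 (fset_set W) i \in fset_set W by exact: mem_nth.
  by rewrite in_fset_set // inE.
have /choice[f Hf] : forall i, exists f : X -> R, [/\ continuous f,
    forall x, 0 <= f x & forall x, 0 < f x <-> nth set0 (fset_set W) i x].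
  by move=> i; exact: continuous_dist_fun.
exists f; split=> [i|i|i x|x]; [by case: (Hf i)..| | ].
  by have [_ _ h] := Hf i => /h.
have : [set: X] x by []; rewrite -cW => -[A WA Ax].
have As : A \in (fset_set W : seq _) by rewrite in_fset_set // inE.
exists (index A (fset_set W)); first by rewrite index_mem.
by have [_ _ h] := Hf (index A (fset_set W)); apply/h; rewrite nth_index.
Qed.

Lemma count_nth_iota (T : Type) (x0 : T) (P : pred T) (s : seq T) :
  count (fun i => P (nth x0 s i)) (iota 0 (size s)) = count P s.
Proof.
by rewrite -(count_map (nth x0 s) P) -/(mkseq (nth x0 s) (size s)) mkseq_nth.
Qed.

(** The member indexed by (i, j) is the set of points at which the cells i and j of the two function
    families overlap. Overlap makes both functions positive, which gives the two refinements; the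
    chain bound gives the order. *)
Lemma refines_finite_open_cover_join (R : realType) (X : topologicalType)
    (W1 W2 : set (set X)) :
  [set: X] !=set0 -> metrizable R X ->
  finite_open_cover W1 -> finite_open_cover W2 ->
  exists W, [/\ finite_open_cover W, refines W W1, refines W W2 &
    ord_cover R W <= ord_cover R W1 + ord_cover R W2].
Proof.
move=> X0 mX cW1 cW2.
have [m -> cm] := ord_cover_nat R X0 cW1.
have [n -> cn] := ord_cover_nat R X0 cW2.
have [f [cf fge fW fp]] := cover_functions mX cW1.
have [g [cg gge gW gp]] := cover_functions mX cW2.
set s1 := (fset_set W1 : seq _) in cm fW fp.
set s2 := (fset_set W2 : seq _) in cn gW gp.
have psum_gt0 (c : nat -> R) p i : (forall k, 0 <= c k) -> (i < p)%N -> 0 < c i ->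
    0 < psum c p.
  move=> c0 ip ci; apply: lt_le_trans (le_psum c0 ip); rewrite psumS.
  by rewrite ltr_wpDl //; exact: sumr_ge0.
pose s := [seq (i, j) | i <- iota 0 (size s1), j <- iota 0 (size s2)].
pose h ij := [set x | overlap (f ^~ x) (g ^~ x) ij].
have in_s i j : (i, j) \in s -> (i < size s1)%N /\ (j < size s2)%N.
  by move=> /allpairsP[[? ?] /= []]; rewrite !mem_iota /= !add0n => ? ? [-> ->].
exists [set h ij | ij in [set` s]]; split.
- apply: finite_open_cover_image => [ij _|x]; first exact: open_overlap.
  have [i is1 fi] := fp x; have [j js2 gj] := gp x.
  have [i' [j' [i's j's ov]]] : exists i j,
    [/\ (i < size s1)%N, (j < size s2)%N & overlap (f ^~ x) (g ^~ x) (i, j)].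
    apply: overlap_exists => [k|k||]; [exact: fge|exact: gge| |].
      by apply: (psum_gt0 _ _ i) => // k; exact: fge.
    by apply: (psum_gt0 _ _ j) => // k; exact: gge.
  by exists (i', j') => //; apply/allpairsP; exists (i', j'); rewrite !mem_iota.
- move=> _ [[i j] /= /in_s[is1 _] <-]; exists (nth set0 s1 i).
    by have := mem_nth set0 is1; rewrite in_fset_set ?inE //; case: cW1.
  by move=> x /= /overlap_gt0[/fW].
- move=> _ [[i j] /= /in_s[_ js2] <-]; exists (nth set0 s2 j).
    by have := mem_nth set0 js2; rewrite in_fset_set ?inE //; case: cW2.
  by move=> x /= /overlap_gt0[_ /gW].
rewrite -natrD; apply: ord_cover_image_le => // x.
rewrite (eq_count (a2 := overlap (f ^~ x) (g ^~ x))); last first.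
  by move=> ij; apply/idP/idP; rewrite inE.
apply: count_overlap => //.
- apply: leq_trans (cm x); rewrite -(count_nth_iota set0); apply: sub_count => k.
  by move=> /fW; exact: mem_set.
- apply: leq_trans (cn x); rewrite -(count_nth_iota set0); apply: sub_count => k.
by move=> /gW; exact: mem_set.
Qed.

(** * Refinements and the functions D(U^F|Y) *)

Definition pullback (X Z : Type) (phi : X -> Z) (W : set (set Z)) : set (set X) :=
  [set phi @^-1` A | A in W].

Lemma finite_open_cover_pullback (X Z : topologicalType) (phi : X -> Z)
    (W : set (set Z)) :
  continuous phi -> finite_open_cover W -> finite_open_cover (pullback phi W).
Proof.
move=> cphi [fW oW cW]; split; first exact: finite_image.
  move=> _ [A WA <-]; apply: open_comp; last exact: oW.
  by move=> x _; exact: cphi.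
apply/seteqP; split => // x _; have : [set: Z] (phi x) by [].
by rewrite -cW => -[A WA Ax]; exists (phi @^-1` A) => //; exists A.
Qed.

Lemma ord_cover_pullback_le (R : realType) (X Z : topologicalType) (phi : X -> Z)
    (W : set (set Z)) :
  [set: X] !=set0 -> finite_open_cover W ->
  ord_cover R (pullback phi W) <= ord_cover R W.
Proof.
move=> X0 cW; have Z0 : [set: Z] !=set0 by have [x _] := X0; exists (phi x).
have [n -> cn] := ord_cover_nat R Z0 cW.
rewrite /pullback -{1}(fset_setK (cover_finite cW)).
apply: ord_cover_image_le => // x; apply: leq_trans (cn (phi x)).
by apply: sub_count => A; rewrite !inE.
Qed.

Lemma refines_pullback (X Z : Type) (phi : X -> Z) (W V : set (set Z)) :
  refines W V -> refines (pullback phi W) (pullback phi V).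
Proof.
move=> WV _ [A /WV[B VB AB] <-]; exists (phi @^-1` B); first by exists B.
exact: preimage_subset.
Qed.
Arguments refines_pullback {X Z} phi {W V} _ _ _.

Lemma refines_refl (X : Type) (U : set (set X)) : refines U U.
Proof. by move=> A UA; exists A. Qed.

Lemma refines_trans (X : Type) (U V W : set (set X)) :
  refines U V -> refines V W -> refines U W.
Proof.
move=> UV VW A /UV[B /VW[C WC BC] AB]; exists C => //; exact: subset_trans AB BC.
Qed.

(** The join is a greatest lower bound for the refinement preorder, so inclusions between joins
    reduce to conjunctions. *)
Lemma refines_joinP (X : Type) (W U V : set (set X)) :
  refines W (join_fam U V) <-> refines W U /\ refines W V.
Proof.
split=> [WUV|[WU WV] A WA].
  split=> A /WUV[_ [B UB [C VC <-]] ABC].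
    by exists B => //; exact: subset_trans ABC (@subIsetl _ _ _).
  by exists C => //; exact: subset_trans ABC (@subIsetr _ _ _).
have [B UB AB] := WU A WA; have [C VC AC] := WV A WA.
by exists (B `&` C); [exists B => //; exists C|rewrite subsetI].
Qed.

Lemma refines_joinl (X : Type) (U V : set (set X)) : refines (join_fam U V) U.
Proof. by have /refines_joinP[] := @refines_refl X (join_fam U V). Qed.

Lemma refines_joinr (X : Type) (U V : set (set X)) : refines (join_fam U V) V.
Proof. by have /refines_joinP[] := @refines_refl X (join_fam U V). Qed.

Lemma refines_join2 (X : Type) (U U' V V' : set (set X)) :
  refines U U' -> refines V V' -> refines (join_fam U V) (join_fam U' V').
Proof.
move=> UU' VV'; apply/refines_joinP; split.
  exact: refines_trans (@refines_joinl _ _ _) UU'.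
exact: refines_trans (@refines_joinr _ _ _) VV'.
Qed.

Lemma finite_open_cover_join (X : topologicalType) (U V : set (set X)) :
  finite_open_cover U -> finite_open_cover V -> finite_open_cover (join_fam U V).
Proof.
move=> [fU oU cU] [fV oV cV]; split; first exact: finite_image2.
  by move=> _ [A UA [B VB <-]]; apply: openI; [exact: oU|exact: oV].
apply/seteqP; split => // x _; have : [set: X] x by [].
rewrite -{1}cU => -[A UA Ax]; have : [set: X] x by [].
rewrite -{1}cV => -[B VB Bx]; exists (A `&` B) => //.
by exists A => //; exists B.
Qed.

Lemma finite_open_coverT (X : topologicalType) :
  finite_open_cover [set [set: X]].
Proof.
split; [exact: finite_set1|by move=> _ ->; exact: openT|].
by rewrite bigcup_set1.
Qed.

Lemma refinesT (X : Type) (U : set (set X)) : refines U [set [set: X]].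
Proof. by move=> A _; exists [set: X]. Qed.

Lemma refines_bigjoinP (X : Type) (I : eqType) (r : seq I) (F : I -> set (set X))
    (W : set (set X)) :
  refines W (\big[@join_fam X/[set [set: X]]]_(i <- r) F i) <->
  forall i, i \in r -> refines W (F i).
Proof.
elim: r => [|i r IH].
  by rewrite big_nil; split=> [_ i|_]; [rewrite in_nil|exact: refinesT].
rewrite big_cons refines_joinP IH; split.
  by move=> [Wi Wr] j; rewrite inE => /predU1P[->|/Wr].
move=> h; split; first by apply: h; exact: mem_head.
by move=> j jr; apply: h; rewrite inE jr orbT.
Qed.

Lemma finite_open_cover_bigjoin (X : topologicalType) (I : eqType) (r : seq I)
    (F : I -> set (set X)) :
  (forall i, i \in r -> finite_open_cover (F i)) ->
  finite_open_cover (\big[@join_fam X/[set [set: X]]]_(i <- r) F i).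
Proof.
move=> cF; rewrite big_seq; apply: big_ind => //; first exact: finite_open_coverT.
exact: finite_open_cover_join.
Qed.

Lemma pullback_comp (X Y Z : Type) (f : X -> Y) (g : Y -> Z) (U : set (set Z)) :
  pullback f (pullback g U) = pullback (g \o f) U.
Proof. by rewrite /pullback image_comp. Qed.

Lemma refines_pullback_join (X Z : Type) (f : X -> Z) (U V : set (set Z)) :
  refines (join_fam (pullback f U) (pullback f V)) (pullback f (join_fam U V)).
Proof.
move=> _ [_ [A UA <-] [_ [B VB <-] <-]]; exists (f @^-1` (A `&` B)) => //.
by exists (A `&` B) => //; exists A => //; exists B.
Qed.

(** * Iterates of a cover under the action *)

Section action.
Variables (G : groupType) (X : topologicalType) (act : G -> X -> X).
Hypotheses (act1 : forall x, act 1%g x = x)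
  (actM : forall g h x, act (g * h)%g x = act g (act h x)).

Lemma image_actV (s : G) (U : set (set X)) :
  [set act s^-1%g @` A | A in U] = pullback (act s) U.
Proof.
rewrite /pullback; apply: eq_imagel => A _; apply/seteqP; split=> x /=.
  by move=> [y Ay <-]; rewrite -actM mulgV act1.
by move=> Asx; exists (act s x) => //; rewrite -actM mulVg act1.
Qed.

(** This property determines the iterate up to mutual refinement. Monotonicity, subadditivity and
    translation in [F] are read off from it, with no reindexing of big joins. *)
Lemma refines_iter_coverP (W U : set (set X)) (F : {fset G}) :
  refines W (iter_cover act U F) <->
  forall s, s \in F -> refines W (pullback (act s) U).
Proof.
rewrite /iter_cover; split=> [/refines_bigjoinP h s sF|h].
  by rewrite -image_actV; exact: h.
by apply/refines_bigjoinP => s sF; rewrite image_actV; exact: h.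
Qed.

Lemma finite_open_cover_iter (U : set (set X)) (F : {fset G}) :
  (forall g, continuous (act g)) -> finite_open_cover U ->
  finite_open_cover (iter_cover act U F).
Proof.
move=> cact cU; apply: finite_open_cover_bigjoin => s _; rewrite image_actV.
exact: finite_open_cover_pullback.
Qed.
End action.

(** * Infimum of orders relative to fibers *)

Section dim.
Variables (R : realType) (X : topologicalType) (Y : Type) (pi : X -> Y).
Hypotheses (X0 : [set: X] !=set0) (mX : metrizable R X).

Lemma ord_cover_ge0 (W : set (set X)) : finite_open_cover W -> 0 <= ord_cover R W.
Proof. by move=> /(ord_cover_nat R X0)[n -> _]. Qed.

Lemma has_lbound_ord_cover (P : set (set X) -> Prop) :
  has_lbound [set ord_cover R W | W in [set W | finite_open_cover W /\ P W]].
Proof. by exists 0 => _ [W [cW _] <-]; exact: ord_cover_ge0. Qed.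

Lemma dim_cover_rel_le (U W : set (set X)) :
  finite_open_cover W -> refines (join_fam (fibers pi) W) U ->
  dim_cover_rel R pi U <= ord_cover R W.
Proof.
by move=> cW WU; apply: ge_inf; [exact: has_lbound_ord_cover|exists W].
Qed.

Lemma dim_cover_rel_nonempty (U : set (set X)) : finite_open_cover U ->
  [set ord_cover R W | W in [set W |
    finite_open_cover W /\ refines (join_fam (fibers pi) W) U]] !=set0.
Proof.
by move=> cU; exists (ord_cover R U), U => //; split => //; exact: refines_joinr.
Qed.

Lemma dim_cover_rel_ge0 (U : set (set X)) : finite_open_cover U ->
  0 <= dim_cover_rel R pi U.
Proof.
move=> cU; apply: lb_le_inf; first exact: dim_cover_rel_nonempty.
by move=> _ [W [cW _] <-]; exact: ord_cover_ge0.
Qed.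

Lemma dim_cover_rel_approx (U : set (set X)) (e : R) :
  finite_open_cover U -> 0 < e ->
  exists W, [/\ finite_open_cover W, refines (join_fam (fibers pi) W) U &
    ord_cover R W < dim_cover_rel R pi U + e].
Proof.
move=> cU e0; have [_ [W [cW WU] <-] lt] := @inf_adherent R _ e e0
  (conj (dim_cover_rel_nonempty cU) (@has_lbound_ord_cover _)).
by exists W.
Qed.

Lemma dim_cover_rel_mono (U V : set (set X)) :
  finite_open_cover U -> refines U V ->
  dim_cover_rel R pi V <= dim_cover_rel R pi U.
Proof.
move=> cU UV; apply/ler_addgt0Pr => e e0.
have [W [cW WU lt]] := dim_cover_rel_approx cU e0.
apply: le_trans (ltW lt); apply: dim_cover_rel_le => //.
exact: refines_trans WU UV.
Qed.

Lemma dim_cover_rel_join (U V : set (set X)) :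
  finite_open_cover U -> finite_open_cover V ->
  dim_cover_rel R pi (join_fam U V) <=
    dim_cover_rel R pi U + dim_cover_rel R pi V.
Proof.
move=> cU cV; apply/ler_addgt0Pr => e e0; have e2 : 0 < e / 2 by rewrite divr_gt0.
have [W1 [cW1 WU lt1]] := dim_cover_rel_approx cU e2.
have [W2 [cW2 WV lt2]] := dim_cover_rel_approx cV e2.
have [W [cW WW1 WW2 leW]] := refines_finite_open_cover_join X0 mX cW1 cW2.
apply: (@le_trans _ _ (ord_cover R W)); last by lra.
apply: dim_cover_rel_le => //; apply/refines_joinP; split.
  by apply: refines_trans WU; apply: refines_join2 => //; exact: refines_refl.
by apply: refines_trans WV; apply: refines_join2 => //; exact: refines_refl.
Qed.
End dim.

(** The only fiber of the map to a point is the whole space, so every result on the relative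
    quantity specializes to the absolute one. *)
Lemma dim_coverE (R : realType) (X : topologicalType) (U : set (set X)) :
  dim_cover R U = dim_cover_rel R (fun=> tt) U.
Proof.
rewrite /dim_cover /dim_cover_rel; congr inf; congr image.
apply/seteqP; split=> W /= [cW WU]; split=> //.
  exact: refines_trans (@refines_joinr _ _ _) WU.
apply: refines_trans WU => A WA; exists A => //.
exists [set: X]; first by exists tt => //; apply/seteqP; split.
by exists A; rewrite ?setTI.
Qed.

Lemma dim_cover_pullback_le (R : realType) (X Z : topologicalType) (phi : X -> Z)
    (U : set (set Z)) :
  [set: X] !=set0 -> continuous phi -> finite_open_cover U ->
  dim_cover R (pullback phi U) <= dim_cover R U.
Proof.
move=> X0 cphi cU; rewrite !dim_coverE; apply/ler_addgt0Pr => e e0.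
have Z0 : [set: Z] !=set0 by have [x _] := X0; exists (phi x).
have [W [cW WU lt]] := dim_cover_rel_approx (fun=> tt) Z0 cU e0.
apply: le_trans (ltW lt); apply: le_trans (ord_cover_pullback_le R phi X0 cW).
rewrite -dim_coverE; apply: ge_inf; first exact: has_lbound_ord_cover.
exists (pullback phi W) => //; split; first exact: finite_open_cover_pullback.
apply: refines_pullback; apply: refines_trans WU => A WA.
exists A => //; exists [set: Z]; first by exists tt => //; apply/seteqP; split.
by exists A; rewrite ?setTI.
Qed.

(** * The relative dimension of an iterate as a function of the finite set *)

Section dim_iter.
Variables (R : realType) (G : groupType) (X : topologicalType) (Y : Type).
Variables (actX : G -> X -> X) (actY : G -> Y -> Y) (pi : X -> Y).
Hypotheses (sX : dynamical_system R actX)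
  (pi_eq : forall g x, pi (actX g x) = actY g (pi x)).
Variable U : set (set X).
Hypothesis cU : finite_open_cover U.

Let X0 := dynsys_nonempty sX.
Let mX := dynsys_metrizable sX.
Let act1 := dynsys_act1 sX.
Let actM := dynsys_actM sX.
Let cact := dynsys_continuous sX.

Lemma dim_iter_ge0 (F : {fset G}) : 0 <= dim_cover_rel R pi (iter_cover actX U F).
Proof. by apply: dim_cover_rel_ge0 => //; exact: finite_open_cover_iter. Qed.

Lemma dim_iter_fset0 : dim_cover_rel R pi (iter_cover actX U fset0) <= 0.
Proof.
apply: (@le_trans _ _ (ord_cover R [set [set: X]])).
  apply: dim_cover_rel_le => //; first exact: finite_open_coverT.
  by apply/(refines_iter_coverP act1 actM) => s; rewrite in_fset0.
apply: (@ord_cover_le R X _ 0%N) => // x.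
by apply: leq_trans (count_size _ _) _; rewrite fset_set1 cardfs1.
Qed.

Lemma dim_iter_mono (F F' : {fset G}) : (F `<=` F')%fset ->
  dim_cover_rel R pi (iter_cover actX U F) <=
  dim_cover_rel R pi (iter_cover actX U F').
Proof.
move=> /fsubsetP FF'; apply: dim_cover_rel_mono => //.
  exact: finite_open_cover_iter.
apply/(refines_iter_coverP act1 actM) => s /FF' sF'.
exact: ((refines_iter_coverP act1 actM _ U F').1 (@refines_refl _ _)).
Qed.

Lemma dim_iter_subadd (F F' : {fset G}) :
  dim_cover_rel R pi (iter_cover actX U (F `|` F')%fset) <=
  dim_cover_rel R pi (iter_cover actX U F) +
  dim_cover_rel R pi (iter_cover actX U F').
Proof.
have cF A : finite_open_cover (iter_cover actX U A).
  exact: finite_open_cover_iter.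
apply: le_trans (dim_cover_rel_join pi X0 mX (cF F) (cF F')).
apply: dim_cover_rel_mono => //; first exact: finite_open_cover_join.
apply/(refines_iter_coverP act1 actM) => s; rewrite in_fsetU => /orP[] sF.
  apply: refines_trans (@refines_joinl _ _ _) _.
  exact: ((refines_iter_coverP act1 actM _ U F).1 (@refines_refl _ _)).
apply: refines_trans (@refines_joinr _ _ _) _.
exact: ((refines_iter_coverP act1 actM _ U F').1 (@refines_refl _ _)).
Qed.

(** If [W] is a witness for [F], its pullback by [actX c] is one for the translate: [actX (k * c)]
    factors through [actX c], and equivariance sends the fiber over y into the fiber over
    [actY c y]. *)
Lemma dim_iter_translate (F : {fset G}) (c : G) :
  dim_cover_rel R pi (iter_cover actX U (left_translate F c)) <=
  dim_cover_rel R pi (iter_cover actX U F).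
Proof.
have cF A : finite_open_cover (iter_cover actX U A).
  exact: finite_open_cover_iter.
apply/ler_addgt0Pr => e e0.
have [W [cW WU lt]] := dim_cover_rel_approx pi X0 (cF F) e0.
apply: le_trans (ltW lt); apply: le_trans (ord_cover_pullback_le R (actX c) X0 cW).
apply: dim_cover_rel_le => //; first exact: finite_open_cover_pullback.
apply/(refines_iter_coverP act1 actM) => _ /imfsetP[k /= kF ->].
have /(refines_iter_coverP act1 actM)/(_ k kF) WUk := WU.
move=> _ [_ [y _ <-] [_ [A WA <-] <-]].
have [|_ [B UB <-] sub] := WUk (pi @^-1` [set actY c y] `&` A).
  by exists (pi @^-1` [set actY c y]); [exists (actY c y)|exists A].
exists (actX (k * c)%g @^-1` B); first by exists B.
move=> x /= [pixy Acx]; rewrite actM; apply: sub; split => //=.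
by rewrite pi_eq pixy.
Qed.
End dim_iter.

(** * From the fibers to a cover of the base *)

Lemma metrizable_hausdorff (R : realType) (Y : topologicalType) :
  metrizable R Y -> hausdorff_space Y.
Proof.
move=> [d [d0 dC dT dN]] p q pq; apply/d0/eqP; rewrite eq_le.
have dge0 x y : 0 <= d x y.
  by have := dT x y x; rewrite (dC y x) (proj2 (d0 x x)) // => ?; lra.
rewrite dge0 andbT leNgt; apply/negP => e0.
have e2 : 0 < d p q / 2 by rewrite divr_gt0.
have [||r [/= pr qr]] := pq [set y | d p y < d p q / 2] [set y | d q y < d p q / 2].
  by apply/dN; exists (d p q / 2).
  by apply/dN; exists (d p q / 2).
by have := dT p r q; rewrite (dC r q) => ?; lra.
Qed.

Lemma compact_finite_cover (Y : topologicalType) (V : Y -> set Y) :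
  [set: Y] !=set0 -> compact [set: Y] ->
  (forall y, open (V y)) -> (forall y, V y y) ->
  exists s : seq Y, forall z, exists2 y, y \in s & V y z.
Proof.
move=> [y0 _] cY oV VV.
pose P : ptopologicalType := HB.pack Y (isPointed.Build Y y0).
have : @cover_compact P [set: P] by rewrite -compact_cover.
move=> /(_ Y setT V)[|z _|s _ sV]; [by move=> y _; exact: oV|by exists z|].
exists s => z; have [y ys Vyz] := sV z I; by exists y.
Qed.

(** A tube argument: each fiber is handled by a choice of members of [U], the same choice works over
    a neighborhood of the base point because a continuous map from a compact space to a Hausdorff
    one is closed, and finitely many neighborhoods cover [Y]. *)
Lemma relative_refinement (R : realType) (X Y : topologicalType) (pi : X -> Y)
    (U W : set (set X)) :
  [set: X] !=set0 -> compact [set: X] -> metrizable R X ->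
  [set: Y] !=set0 -> compact [set: Y] -> metrizable R Y -> continuous pi ->
  U `<=` open -> finite_open_cover W -> refines (join_fam (fibers pi) W) U ->
  exists W' V, [/\ finite_open_cover W', finite_open_cover V,
    ord_cover R W' <= ord_cover R W &
    refines (join_fam (pullback pi V) W') U].
Proof.
move=> X0 cX mX Y0 cY mY cpi oU cW WU.
have [f [cf fge fW fp]] := cover_functions mX cW.
have [n -> cn] := ord_cover_nat R X0 cW.
set s := (fset_set W : seq _) in cn fW fp *.
pose S x := psum (f ^~ x) (size s).
have S0 x : 0 < S x.
  have [i ip fi] := fp x; apply: lt_le_trans (le_psum (fge ^~ x) ip).
  by rewrite psumS ltr_wpDl //; exact: sumr_ge0.
have [c _ Sc] : exists2 c : X, c \in [set: X] & forall x, x \in [set: X] -> S c <= S x.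
  apply: compact_EVT_min => //; apply: continuous_subspaceT.
  exact: continuous_psum.
have p0 : (0 < size s)%N by have [i ip _] := fp c; exact: leq_ltn_trans ip.
(* At every point some [f i] is at least the average, hence at least the minimum [S c] divided by
   the number of functions. Half of this is a threshold that is strictly exceeded. *)
pose t := S c / (size s)%:R / 2.
have t0 : 0 < t by rewrite !divr_gt0 // ltr0n.
have ft x : exists2 i, i \in iota 0 (size s) & t < f i x.
  apply: contrapT => /forall2NP nf; have := Sc x (mem_set I).
  apply/negP; rewrite -ltNge; apply: (@le_lt_trans _ _ (\sum_(0 <= k < size s) t)).
    rewrite /S /psum !big_nat; apply: ler_sum => i /andP[_ ip]; rewrite leNgt.
    by case: (nf i) => [|/negP //]; rewrite mem_iota add0n ip.
  rewrite big_const_nat subn0 iter_addr addr0 -mulr_natr /t.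
  have ns : (size s)%:R != 0 :> R by rewrite pnatr_eq0 -lt0n.
  rewrite (_ : _ * _ = S c / 2); last by field.
  by have := S0 c; lra.
have /choice[B HB] : forall yi : Y * nat, exists B, (yi.2 < size s)%N ->
    U B /\ pi @^-1` [set yi.1] `&` nth set0 s yi.2 `<=` B.
  move=> [y i] /=; have [h|h] := ltnP i (size s); last by exists set0.
  have [|C UC sub] := WU (pi @^-1` [set y] `&` nth set0 s i); last by exists C.
  exists (pi @^-1` [set y]); first by exists y.
  by exists (nth set0 s i) => //; have := mem_nth set0 h;
    rewrite in_fset_set ?inE //; case: cW.
(* The points where the choice made for y fails, taken over the closed sets [t <= f i] so that [C y]
   is closed; its image misses y. *)
pose C y := \bigcup_(i in [set` iota 0 (size s)]) ([set x | t <= f i x] `\` B (y, i)).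
have CP y x : C y x <-> exists2 i, (i < size s)%N & t <= f i x /\ ~ B (y, i) x.
  split=> [[i /= + [? ?]]|[i ip [? ?]]].
    by rewrite mem_iota add0n => ip; exists i.
  by exists i => //=; rewrite mem_iota add0n.
have clC y : closed (C y).
  apply: closed_bigcup => [|i /=]; first exact: finite_seq.
  rewrite mem_iota add0n => ip.
  have [UB _] := HB (y, i) ip; apply: closedI; last exact/open_closedC/oU.
  rewrite (_ : [set x | _] = ~` [set x | f i x < t]); last first.
    by apply/seteqP; split=> x /=; rewrite leNgt => /negP.
  by apply/open_closedC/open_lt_fun => // x; exact: cvg_cst.
pose V y := ~` (pi @` C y).
have oV y : open (V y).
  apply: closed_openC; apply: compact_closed; first exact: metrizable_hausdorff mY.
  apply: continuous_compact; first exact: continuous_subspaceT.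
  exact: subclosed_compact (clC y) cX _.
have VV y : V y y.
  move=> [x /CP[i ip [tf nB]] pixy]; apply: nB.
  have [_ sub] := HB (y, i) ip; apply: sub; split => //=.
  by apply: fW; exact: lt_le_trans tf.
have [l lV] := compact_finite_cover Y0 cY oV VV.
exists [set [set x | t < f i x] | i in [set` iota 0 (size s)]],
  [set V y | y in [set` l]]; split.
- apply: finite_open_cover_image => // i _.
  by apply: open_lt_fun => // x; exact: cvg_cst.
- by apply: finite_open_cover_image.
- apply: ord_cover_image_le => // x; apply: leq_trans (cn x).
  rewrite -(count_nth_iota set0); apply: sub_count => i /=.
  by rewrite !inE /= => tf; apply: fW; exact: lt_trans tf.
move=> _ [_ [_ [y _ <-] <-] [_ [i + <-] <-]] /=.
move=> ip; have {}ip : (i < size s)%N by move: ip => /=; rewrite mem_iota add0n.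
have [UB _] := HB (y, i) ip.
exists (B (y, i)) => // x [/= Vx tf]; apply: contrapT => nB; apply: Vx.
by exists x => //; apply/CP; exists i => //; split => //; exact: ltW.
Qed.

(** * Quasi-tilings *)

Lemma card_fset_sep (T : choiceType) (A : {fset T}) (P : pred T) :
  #|` [fset x in A | P x]%fset| = count P A.
Proof.
rewrite -size_filter; apply/perm_size/uniq_perm; rewrite ?filter_uniq ?fset_uniq //.
by move=> x; rewrite !inE mem_filter andbC.
Qed.

Lemma card_fset_sepC (T : choiceType) (A : {fset T}) (P : pred T) :
  (#|` [fset x in A | P x]%fset| + #|` [fset x in A | ~~ P x]%fset| = #|` A|)%N.
Proof. by rewrite !card_fset_sep; exact: count_predC. Qed.

Lemma card_bigfcup_le (T : choiceType) (I : eqType) (r : seq I) (F : I -> {fset T}) :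
  (#|` \bigcup_(i <- r) F i|%fset <= \sum_(i <- r) #|` F i|)%N.
Proof.
elim: r => [|i r IH]; first by rewrite !big_nil cardfs0.
rewrite !big_cons; apply: leq_trans (leq_add (leqnn _) IH).
by rewrite cardfsU leq_subr.
Qed.

Section tiling.
Variable G : groupType.
Implicit Types (K T A E C : {fset G}).

Definition bad K A : nat :=
  #|` [fset t in A | ~~ (left_translate K t `<=` A)%fset]%fset|.

Definition lmul (k : G) T : {fset G} := [fset (k * s)%g | s in T]%fset.

(** Counts the pairs (k, t) with k in [K], t outside [T] and k t in [T]. This is the outer boundary
    that governs what removing a translate of [T] does to invariance under [K]. *)
Definition escape K T : nat := \sum_(k <- K) #|` lmul k^-1 T `\` T|%fset.

Definition tile_union T C : {fset G} := (\bigcup_(c <- C) left_translate T c)%fset.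

Lemma in_left_translate K t x : (x \in left_translate K t) = ((x * t^-1)%g \in K).
Proof.
apply/imfsetP/idP => [[k /= kK ->]|xK]; first by rewrite mulgK.
by exists (x * t^-1)%g => //; rewrite mulgVK.
Qed.

Lemma in_lmul k T x : (x \in lmul k^-1 T) = ((k * x)%g \in T).
Proof.
apply/imfsetP/idP => [[s /= sT ->]|xT]; first by rewrite mulVKg.
by exists (k * x)%g => //; rewrite mulKg.
Qed.

Lemma left_translate_subP K t A :
  (left_translate K t `<=` A)%fset <-> forall k, k \in K -> (k * t)%g \in A.
Proof.
split=> [/fsubsetP h k kK|h]; first by apply: h; exact: in_imfset.
by apply/fsubsetP => _ /imfsetP[k /= kK ->]; exact: h.
Qed.

Lemma card_left_translate K t : #|` left_translate K t| = #|` K|.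
Proof. by rewrite card_imfset //; exact: mulIg. Qed.

Lemma card_lmul k T : #|` lmul k T| = #|` T|.
Proof. by rewrite card_imfset //; exact: mulgI. Qed.

Lemma bad_subset K K' A : (K `<=` K')%fset -> (bad K A <= bad K' A)%N.
Proof.
move=> /fsubsetP KK'; rewrite /bad !card_fset_sep; apply: sub_count => t.
apply: contra => /left_translate_subP h; apply/left_translate_subP => k kK.
exact/h/KK'.
Qed.

Lemma folner_bad_le (R : realType) K (delta : R) A :
  folner_set K delta A -> (bad K A)%:R <= delta * #|` A|%:R.
Proof.
move=> [_]; have := card_fset_sepC A (fun t => left_translate K t `<=` A)%fset.
move=> /(congr1 (fun n => n%:R : R)); rewrite natrD -/(bad K A).
by move=> h1 h2; lra.
Qed.

(** Since k^-1 T and T have equal size, their two differences have equal size, and a point t of T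
    outside k^-1 T has k t outside T, so it is bad. *)
Lemma escape_le_bad K T : (escape K T <= #|` K| * bad K T)%N.
Proof.
rewrite /escape -sum1_size big_distrl /= !big_seq; apply: leq_sum => k kK.
rewrite mul1n cardfsD card_lmul [(_ `&` _)%fset]fsetIC -cardfsD.
apply: fsubset_leq_card; apply/fsubsetP => t; rewrite !inE in_lmul.
move=> /andP[ktT tT]; rewrite tT /=; apply: contra ktT.
by move=> /left_translate_subP; exact.
Qed.

(** Double counting: for fixed k the map c to k c is injective, so at most |E| values of c send k
    into [E]. *)
Lemma tile_overlap_sum T E C :
  (\sum_(c <- C) #|` [fset k in T | (k * c)%g \in E]%fset| <= #|` T| * #|` E|)%N.
Proof.
rewrite (eq_bigr (fun c => \sum_(k <- T | (k * c)%g \in E) 1)%N); last first.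
  by move=> c _; rewrite card_fset_sep sum1_count.
rewrite (exchange_big_dep predT) //= -sum1_size big_distrl /=; apply: leq_sum => k _.
rewrite mul1n sum1_count -card_fset_sep -(card_lmul k).
apply: fsubset_leq_card; apply/fsubsetP => x /imfsetP[c /= + ->].
by rewrite !inE => /andP[].
Qed.

Lemma card_tile_unionU1 T C c :
  (#|` left_translate T c `|` tile_union T C|%fset +
   #|` [fset k in T | (k * c)%g \in tile_union T C]%fset| =
   #|` T| + #|` tile_union T C|)%N.
Proof.
rewrite -[in RHS](card_left_translate T c) -[RHS]cardfsUI. congr addn.
rewrite -[LHS](card_left_translate _ c); congr (#|` _|); apply/fsetP => x.
by rewrite in_left_translate !inE in_left_translate mulgVK.
Qed.

(* A largest family of centers whose translates are disjoint up to a fraction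
   [e] meets every further admissible translate in at least that fraction. *)
Lemma greedy_tiles (R : realType) (e : R) T A : e <= 1 ->
  exists C, [/\ forall c, c \in C -> c \in A /\ (left_translate T c `<=` A)%fset,
    (1 - e) * #|` T|%:R * #|` C|%:R <= #|` tile_union T C|%:R &
    e * #|` T|%:R * #|` [fset t in A | left_translate T t `<=` A]%fset|%:R <=
      #|` T|%:R * #|` tile_union T C|%:R].
Proof.
move=> e1; set good := [fset t in A | left_translate T t `<=` A]%fset.
pose ok C := (C `<=` good)%fset /\
  (1 - e) * #|` T|%:R * #|` C|%:R <= #|` tile_union T C|%:R.
have ex : exists n, `[< exists2 C, ok C & #|` C| = n >].
  exists 0%N; apply/asboolP; exists fset0; last exact: cardfs0.
  by split; [exact: fsub0set|rewrite cardfs0 mulr0].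
have ub n : `[< exists2 C, ok C & #|` C| = n >] -> (n <= #|` good|)%N.
  by move=> /asboolP[C [Cg _] <-]; exact: fsubset_leq_card.
case: (ex_maxnP ex ub) => n /asboolP[C [Cg okC] Cn] nmax.
exists C; split=> //.
  by move=> c /(fsubsetP Cg); rewrite !inE => /andP[].
set E := tile_union T C.
have overlap_ge c : c \in good ->
    e * #|` T|%:R <= #|` [fset k in T | (k * c)%g \in E]%fset|%:R :> R.
  move=> cg; have [cC|cC] := boolP (c \in C).
    have -> : [fset k in T | (k * c)%g \in E]%fset = T.
      apply/fsetP => k; rewrite !inE; have [kT|//] := boolP (k \in T).
      by apply/bigfcupP; exists c; rewrite ?cC //; exact: in_imfset.
    by rewrite ler_piMl.
  rewrite leNgt; apply/negP => lt_e.
  suff : (n.+1 <= n)%N by rewrite ltnn.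
  apply: nmax; apply/asboolP; exists (c |` C)%fset; last by rewrite cardfsU1 cC Cn.
  split; first by rewrite fsubUset Cg fsub1set cg.
  have -> : tile_union T (c |` C)%fset = (left_translate T c `|` E)%fset.
    by rewrite /tile_union big_fsetU1.
  have := card_tile_unionU1 T C c; rewrite -/E.
  move=> /(congr1 (fun n => n%:R : R)); rewrite !natrD => cardE.
  rewrite cardfsU1 cC natrD mulrDr mulr1.
  have := okC; rewrite -/E => {}okC; lra.
have := tile_overlap_sum T E good.
rewrite -(ler_nat R) natrM natr_sum => /(le_trans _); apply.
rewrite -[#|` good|]sum1_size natr_sum mulr_sumr !big_seq.
by apply: ler_sum => c cg; rewrite mulr1; exact: overlap_ge.
Qed.

(** A newly bad point t has some k t in a removed tile T c while t is outside it; translating by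
    c^-1 gives a pair counted by [escape K T]. *)
Lemma bad_fsetD_le K T A C :
  (bad K (A `\` tile_union T C)%fset <= bad K A + #|` C| * escape K T)%N.
Proof.
pose B c := (\bigcup_(k <- K) left_translate (lmul k^-1 T `\` T) c)%fset.
have cardB c : (#|` B c| <= escape K T)%N.
  apply: leq_trans (card_bigfcup_le _ _) _; apply: leq_sum => k _.
  by rewrite card_left_translate.
pose badA := [fset t in A | ~~ (left_translate K t `<=` A)]%fset.
apply: (@leq_trans #|` badA `|` \bigcup_(c <- C) B c|%fset).
  apply: fsubset_leq_card; apply/fsubsetP => t; rewrite !inE /=.
  move=> /andP[/andP[tU tA] nsub].
  have [sub|/negP nsubA] := boolP (left_translate K t `<=` A)%fset; last first.
    by rewrite tA; apply/orP; left; exact/negP.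
  apply/orP; right; move: nsub => /fsubsetPn[x].
  rewrite in_left_translate => xK; rewrite in_fsetD negb_and negbK.
  have xA : x \in A.
    by apply: (fsubsetP sub); rewrite in_left_translate.
  rewrite xA orbF => /bigfcupP[c /andP[cC _]].
  rewrite in_left_translate => xT; apply/bigfcupP; exists c; first by rewrite cC.
  apply/bigfcupP; exists (x * t^-1)%g; first by rewrite xK.
  rewrite in_left_translate in_fsetD in_lmul mulgA mulgVK xT andbT.
  apply: contra tU => tT; apply/bigfcupP; exists c; first by rewrite cC.
  by rewrite in_left_translate.
apply: (@leq_trans (#|` badA| + #|` \bigcup_(c <- C) B c|%fset)).
  by rewrite cardfsU leq_subr.
rewrite leq_add2l; apply: leq_trans (card_bigfcup_le _ _) _.
by rewrite -sum1_size big_distrl /=; apply: leq_sum => c _; rewrite mul1n.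
Qed.

Definition tiled (l : seq ({fset G} * G)) : {fset G} :=
  (\bigcup_(p <- l) left_translate p.1 p.2)%fset.

(** Here [N] is the size of the original set and [A] is what remains. If |A| > e N, the bound on bad
    points and 6 delta <= e leave at least (e/2) N good centers, and the greedy tiles cover a
    fraction e of that number: hence e^2/2 per shape. The term 2 delta (N - |A|) records the
    invariance lost so far, in proportion to what was removed. *)
Lemma fill (R : realType) (e delta N : R) (ts : seq {fset G}) A :
  0 < e -> e <= 2^-1 -> 0 <= delta -> 6 * delta <= e ->
  pairwise (fun T K => (escape K T)%:R <= delta * #|` T|%:R) ts ->
  fset0 \notin ts -> #|` A|%:R <= N ->
  (forall T, T \in ts -> (bad T A)%:R <= delta * N + 2 * delta * (N - #|` A|%:R)) ->
  exists l, [/\ forall p, p \in l -> [/\ p.1 \in ts, p.2 \in A &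
      (left_translate p.1 p.2 `<=` A)%fset],
    (1 - e) * (\sum_(p <- l) #|` p.1|)%:R <= #|` tiled l|%:R &
    #|` A `\` tiled l|%fset%:R <= e * N \/
    #|` A `\` tiled l|%fset%:R <= #|` A|%:R - (size ts)%:R * (e ^+ 2 / 2 * N)].
Proof.
move=> e0 e2 d0 de; elim: ts A => [|T ts IH] A.
  move=> _ _ AN _; exists [::]; rewrite /tiled !big_nil mulr0 cardfs0.
  by split=> //; right; rewrite fsetD0 mul0r subr0.
rewrite pairwise_cons => /andP[/allP escT pts].
rewrite inE negb_or eq_sym => /andP[T0 ts0] AN badA.
have [small|big] := leP #|` A|%:R (e * N).
  exists [::]; rewrite /tiled !big_nil mulr0 cardfs0.
  by split=> //; left; rewrite fsetD0.
have [|C [CA Cle Cge]] := @greedy_tiles R e T A; first by lra.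
set E := tile_union T C in Cle Cge.
have Tpos : 0 < #|` T|%:R :> R by rewrite ltr0n cardfs_gt0.
have EA : (E `<=` A)%fset.
  by apply/fsubsetP => x /bigfcupP[c /andP[/CA[_ /fsubsetP h] _] /h].
have cardD : #|` A `\` E|%fset%:R = #|` A|%:R - #|` E|%:R :> R.
  by rewrite cardfsDS // natrB // fsubset_leq_card.
have N0 : 0 <= N by apply: le_trans AN.
have Ege : e ^+ 2 / 2 * N <= #|` E|%:R.
  have := card_fset_sepC A (fun t => left_translate T t `<=` A)%fset.
  rewrite -/(bad T A) => /(congr1 (fun n => n%:R : R)); rewrite natrD => cardA.
  have bT := badA T (mem_head _ _).
  have : e * #|` [fset t in A | left_translate T t `<=` A]%fset|%:R <= #|` E|%:R.
    by rewrite -(ler_pM2l Tpos) mulrCA mulrA.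
  apply: le_trans; rewrite expr2 -!mulrA ler_pM2l //.
  have h1 : 0 <= (e - 6 * delta) * N by rewrite mulr_ge0 // subr_ge0.
  have h2 : 0 <= delta * #|` A|%:R by rewrite mulr_ge0.
  by lra.
(* As 1 - e >= 1/2, the tiles have total size at most twice their union: the source of the factor 2
   in the invariance hypothesis. *)
have CTE : #|` C|%:R * #|` T|%:R <= 2 * #|` E|%:R :> R.
  have h1 : 0 <= (2^-1 - e) * (#|` C|%:R * #|` T|%:R).
    by rewrite mulr_ge0 ?subr_ge0 // mulr_ge0.
  by lra.
have [|T' T'ts|l [lA lle lrest]] := IH (A `\` E)%fset pts ts0.
- by rewrite cardD; apply: le_trans AN; rewrite lerBlDr lerDl.
- have := bad_fsetD_le T' T A C; rewrite -/E -(ler_nat R) natrD natrM => h.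
  have h1 := badA T' _; have h2 := escT T' T'ts.
  apply: le_trans h _; rewrite cardD.
  have h3 : #|` C|%:R * (escape T' T)%:R <= 2 * delta * #|` E|%:R.
    apply: (@le_trans _ _ (#|` C|%:R * (delta * #|` T|%:R))).
      by rewrite ler_wpM2l.
    rewrite mulrCA [2 * _]mulrC -mulrA; exact: ler_wpM2l.
  rewrite inE T'ts orbT in h1; have := h1 isT; lra.
have tl : tiled ([seq (T, c) | c <- C] ++ l) = (E `|` tiled l)%fset.
  by rewrite /tiled big_cat big_map.
have tlA : (tiled l `<=` A `\` E)%fset.
  by apply/fsubsetP => x /bigfcupP[c /andP[/lA[_ _ /fsubsetP h] _] /h].
exists ([seq (T, c) | c <- C] ++ l); rewrite tl; split.
- move=> p; rewrite mem_cat => /orP[/mapP[c cC ->] /=|/lA[pts' pA sub]].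
    by have [? ?] := CA c cC; rewrite mem_head.
  split; first by rewrite inE pts' orbT.
    by move: pA; rewrite in_fsetD => /andP[].
  exact: fsubset_trans sub (fsubsetDl _ _).
- have -> : #|` (E `|` tiled l)%fset| = (#|` E| + #|` tiled l|)%N.
    rewrite -cardfsUI [(_ `&` _)%fset](_ : _ = fset0) ?cardfs0 ?addn0 //.
    apply/fsetP => x; rewrite in_fsetI in_fset0; apply/negP => /andP[xE].
    by move=> /(fsubsetP tlA); rewrite in_fsetD xE.
  rewrite big_cat big_map /= big_const_seq count_predT iter_addn_0 !natrD natrM.
  by rewrite mulrDr; apply: lerD => //; rewrite mulrA.
rewrite -fsetDDl; case: lrest => [|lrest]; [by left|right].
by apply: le_trans lrest _; rewrite cardD -[(size (T :: ts))%:R]natr1; lra.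
Qed.

(** The shapes are built in the reverse of the order of use: each new one is nearly invariant under
    all those already present and is put at the head of the list, to be placed before them. *)
Lemma quasi_tiling (R : realType) (P : set {fset G}) (e : R) :
  (forall K (delta : R), K != fset0 -> 0 < delta ->
     exists2 F, folner_set K delta F & P F) ->
  0 < e -> e <= 2^-1 ->
  exists (ts : seq {fset G}) K (delta : R),
    [/\ forall T, T \in ts -> P T /\ T != fset0, K != fset0, 0 < delta &
    forall F, folner_set K delta F ->
    exists l, [/\ forall p, p \in l -> [/\ p.1 \in ts, p.2 \in F &
        (left_translate p.1 p.2 `<=` F)%fset],
      (\sum_(p <- l) #|` p.1|)%:R <= (1 + 2 * e) * #|` F|%:R :> R &
      #|` F `\` tiled l|%fset%:R <= e * #|` F|%:R]].
Proof.
move=> freq e0 e2; pose delta := e / 6.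
have d0 : 0 < delta by rewrite divr_gt0.
pose supp (ts : seq {fset G}) := (1%g |` \bigcup_(T <- ts) T)%fset.
have supp0 ts : supp ts != fset0.
  by apply/fset0Pn; exists 1%g; rewrite in_fsetU in_fset1 eqxx.
have sub_supp ts T : T \in ts -> (T `<=` supp ts)%fset.
  move=> Tts; apply/fsubsetP => x xT; rewrite in_fsetU; apply/orP; right.
  by apply/bigfcupP; exists T; rewrite ?Tts.
have tower n : exists ts : seq {fset G}, [/\ size ts = n,
    pairwise (fun T K => (escape K T)%:R <= delta * #|` T|%:R) ts &
    forall T, T \in ts -> P T /\ T != fset0].
  elim: n => [|n [ts [sz pw tsP]]]; first by exists [::].
  have K0 : 0 < #|` supp ts|%:R :> R by rewrite ltr0n cardfs_gt0.
  (* Dividing by the size of the support pays in advance for the factor |K| in [escape_le_bad]. *)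
  have [T Tf PT] := freq (supp ts) (delta / #|` supp ts|%:R)
    (supp0 ts) (divr_gt0 d0 K0).
  exists (T :: ts); split; first by rewrite /= sz.
    rewrite pairwise_cons pw andbT; apply/allP => K Kts.
    apply: (@le_trans _ _ (#|` K| * bad K T)%N%:R).
      by rewrite ler_nat escape_le_bad.
    have := folner_bad_le Tf; have := sub_supp _ _ Kts => sK.
    have : (#|` K| * bad K T <= #|` supp ts| * bad (supp ts) T)%N.
      by rewrite leq_mul ?bad_subset ?fsubset_leq_card.
    rewrite -(ler_nat R) => /le_trans h1 h2; apply: h1; rewrite natrM.
    by rewrite -ler_pdivlMl // mulrA [_^-1 * _]mulrC.
  move=> T'; rewrite inE => /predU1P[->|/tsP //]; split=> //.
  by case: Tf.
(* With this many shapes, the second alternative of [fill] leaves nothing uncovered. *)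
have [n nP] : exists n : nat, 1 <= n%:R * (e ^+ 2 / 2).
  exists (Num.bound (e ^+ 2 / 2)^-1).
  rewrite -ler_pdivrMr ?divr_gt0 ?exprn_gt0 // mul1r.
  by apply/ltW/archi_boundP; rewrite invr_ge0 divr_ge0 // exprn_ge0 // ltW.
have [ts [sz pw tsP]] := tower n.
exists ts, (supp ts), delta; split=> // F Ff.
have [||T Tts|l [lF lle lrest]] :=
  @fill R e delta #|` F|%:R ts F e0 e2 (ltW d0) _ pw _ (lexx _).
- by rewrite /delta; lra.
- by apply/negP => /tsP[_]; rewrite eqxx.
- rewrite subrr mulr0 addr0; apply: le_trans (folner_bad_le Ff).
  by rewrite ler_nat bad_subset ?sub_supp.
exists l; split=> //.
  have lF' : #|` tiled l|%:R <= #|` F|%:R :> R.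
    rewrite ler_nat; apply: fsubset_leq_card.
    by apply/fsubsetP => x /bigfcupP[c /andP[/lF[_ _ /fsubsetP h] _] /h].
  set S := _%:R in lle *; have S0 : 0 <= S by exact: ler0n.
  apply: (@le_trans _ _ ((1 + 2 * e) * ((1 - e) * S))).
    (* (1 + 2e)(1 - e) = 1 + e(1 - 2e), which is at least 1 because e <= 1/2. *)
    have : 0 <= e * (1 - 2 * e) * S by rewrite !mulr_ge0 //; lra.
    by lra.
  rewrite ler_pM2l; first exact: le_trans lF'.
  by lra.
case: lrest => // /le_trans; apply; rewrite sz.
apply: (@le_trans _ _ 0); last by rewrite mulr_ge0 // ltW.
by rewrite subr_le0 mulrA ler_peMl.
Qed.
End tiling.

(** * Subadditive functions on finite subsets *)

Lemma folner_set_subset (R : realType) (G : groupType) (K K' : {fset G})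
    (delta delta' : R) :
  (K `<=` K')%fset -> delta' <= delta -> folner_set K' delta' `<=` folner_set K delta.
Proof.
move=> KK' dd F [F0 Ff]; split=> //.
apply: (@le_trans _ _ ((1 - delta') * #|` F|%:R)); first by rewrite ler_wpM2r // lerB.
apply: le_trans Ff _; rewrite ler_nat !card_fset_sep; apply: sub_count => t.
exact/fsubset_trans/subset_imfset/(fsubsetP KK').
Qed.

Lemma folner_filter_proper (R : realType) (G : groupType) :
  amenable R G -> ProperFilter (folner_filter R G).
Proof.
move=> amG; apply: filter_from_proper; last by move=> [K d] [K0 d0]; exact: amG.
apply: filter_from_filter.
  by exists ([fset 1%g]%fset, 1); split=> //=; apply/fset0Pn;
    exists 1%g; rewrite in_fset1.
move=> [K1 d1] [K2 d2] [/= K10 d10] [/= K20 d20].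
exists ((K1 `|` K2)%fset, Num.min d1 d2).
  split=> /=; last by rewrite lt_min d10.
  by apply: contra K10 => /eqP h; rewrite -fsubset0 -h fsubsetUl.
move=> F /= Ff; split; apply: folner_set_subset Ff.
- exact: fsubsetUl.
- by rewrite ge_min lexx.
- exact: fsubsetUr.
- by rewrite ge_min lexx orbT.
Qed.

Lemma near_folner_frequently (R : realType) (G : groupType) (P : set {fset G}) :
  amenable R G -> (\forall F \near folner_filter R G, P F) ->
  forall K (delta : R), K != fset0 -> 0 < delta ->
    exists2 F, folner_set K delta F & P F.
Proof.
move=> amG nP K d K0 d0; have PF := folner_filter_proper amG.
have : \forall F \near folner_filter R G, folner_set K d F by exists (K, d).
move=> nK; have [F [? ?]] := filter_ex (filterI nK nP).
by exists F.
Qed.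

Section subadditive.
Variables (R : realType) (G : groupType) (h : {fset G} -> R).
Hypotheses (h0 : h fset0 <= 0) (h_ge0 : forall F, 0 <= h F)
  (h_mono : forall F F', (F `<=` F')%fset -> h F <= h F')
  (h_subadd : forall F F', h (F `|` F')%fset <= h F + h F')
  (h_translate : forall F c, h (left_translate F c) <= h F).

Lemma le_tiled (l : seq ({fset G} * G)) : h (tiled l) <= \sum_(p <- l) h p.1.
Proof.
rewrite /tiled; elim: l => [|p l IH]; first by rewrite !big_nil.
rewrite !big_cons; apply: le_trans (h_subadd _ _) _; exact: lerD.
Qed.

Lemma le_linear (F : {fset G}) : h F <= h [fset 1%g]%fset * #|` F|%:R.
Proof.
pose l : seq ({fset G} * G) := [seq ([fset 1%g]%fset, x) | x <- F].
apply: (@le_trans _ _ (h (tiled l))).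
  apply: h_mono; apply/fsubsetP => x xF; apply/bigfcupP.
  exists ([fset 1%g]%fset, x); first by rewrite map_f.
  by rewrite in_left_translate mulgV in_fset1.
apply: le_trans (le_tiled l) _.
by rewrite big_map /= big_const_seq count_predT iter_addr addr0 mulr_natr.
Qed.

(** Sets with ratio at most [c] occur at every level of invariance, so they can be the tiles of all
    sufficiently invariant [F]; the uncovered part is paid for point by point through
    [le_linear]. *)
Lemma frequently_le_near (c e : R) :
  (forall K (delta : R), K != fset0 -> 0 < delta ->
     exists2 F, folner_set K delta F & h F <= c * #|` F|%:R) ->
  0 <= c -> 0 < e ->
  \forall F \near folner_filter R G, h F <= (c + e) * #|` F|%:R.
Proof.
move=> freq c0 e0; pose M := h [fset 1%g]%fset.
have M0 : 0 <= M by exact: h_ge0.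
(* Repeated covering costs 2 c e1 and the uncovered part M e1, per element of F; the added 1 keeps
   the denominator positive. *)
pose e1 := Num.min 2^-1 (e / (2 * c + M + 1)).
have pos : 0 < 2 * c + M + 1 by lra.
have e10 : 0 < e1 by rewrite lt_min invr_gt0 ltr0n divr_gt0.
have e1half : e1 <= 2^-1 by rewrite ge_min lexx.
have e1e : e1 * (2 * c + M + 1) <= e by rewrite -ler_pdivlMr // ge_min lexx orbT.
have [ts [K [d [tsP K0 d0 til]]]] := quasi_tiling freq e10 e1half.
exists (K, d) => // F /= /til[l [lP lle lrest]].
apply: (@le_trans _ _ (h (tiled l `|` (F `\` tiled l))%fset)).
  apply: h_mono; apply/fsubsetP => x xF.
  by rewrite in_fsetU in_fsetD xF andbT orbN.
apply: le_trans (h_subadd _ _) _.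
have h1 : h (tiled l) <= c * (\sum_(p <- l) #|` p.1|)%:R.
  apply: le_trans (le_tiled l) _; rewrite natr_sum mulr_sumr !big_seq.
  by apply: ler_sum => p /lP[/tsP[]].
have h2 := le_linear (F `\` tiled l)%fset; rewrite -/M in h2.
have h3 := ler_wpM2l c0 lle; have h4 := ler_wpM2l M0 lrest.
have h5 : 0 <= (e - e1 * (2 * c + M + 1)) * #|` F|%:R.
  by rewrite mulr_ge0 // subr_ge0.
have h6 : 0 <= e1 * #|` F|%:R by rewrite mulr_ge0 // ltW.
by lra.
Qed.

(** [inf S] is the lower limit of the ratio along Folner sets, and [frequently_le_near] shows that
    the upper limit does not exceed it. *)
Lemma ornstein_weiss : amenable R G ->
  exists l : R, h F / #|` F|%:R @[F --> folner_filter R G] --> l.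
Proof.
move=> amG; have PF := folner_filter_proper amG.
pose S := [set c : R | forall K (delta : R), K != fset0 -> 0 < delta ->
     exists2 F, folner_set K delta F & h F <= c * #|` F|%:R].
have Fpos (K : {fset G}) (d : R) F : folner_set K d F -> 0 < #|` F|%:R :> R.
  by case=> F0 _; rewrite ltr0n cardfs_gt0.
have Sge0 c : S c -> 0 <= c.
  move=> /(_ [fset 1%g]%fset 1) []//.
    by apply/fset0Pn; exists 1%g; rewrite in_fset1.
  move=> F /Fpos F0 hF; rewrite -(pmulr_lge0 _ F0).
  exact: le_trans (h_ge0 F) hF.
have Sne : S !=set0.
  exists (h [fset 1%g]%fset) => K d K0 d0.
  by have [F Ff] := amG K d K0 d0; exists F => //; exact: le_linear.
have lbS : has_lbound S by exists 0 => c /Sge0.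
exists (inf S); apply/cvgrPdist_lt => e e0; have e2 : 0 < e / 3 by lra.
have [c Sc cinf] := inf_adherent e2 (conj Sne lbS).
have up := frequently_le_near Sc (Sge0 _ Sc) e2.
have : ~ S (inf S - e / 3).
  by move=> /(ge_inf lbS); lra.
move=> /existsNP[K /existsNP[d /not_implyP[K0 /not_implyP[d0 nF]]]].
have low : \forall F \near folner_filter R G, folner_set K d F by exists (K, d).
apply: filterS2 up low => F hF Ff; have F0 := Fpos _ _ _ Ff.
have hF2 : (inf S - e / 3) * #|` F|%:R < h F.
  by rewrite ltNge; apply/negP => hF2; apply: nF; exists F.
rewrite -ltr_pdivlMr // in hF2; rewrite -ler_pdivrMr // in hF.
by rewrite ltr_norml; lra.
Qed.
End subadditive.

(** * Mean dimension *)

Lemma dim_iter_linear (R : realType) (G : groupType) (X : topologicalType)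
    (act : G -> X -> X) (U : set (set X)) (F : {fset G}) :
  dynamical_system R act -> finite_open_cover U ->
  dim_cover R (iter_cover act U F) <=
    dim_cover R (iter_cover act U [fset 1%g]%fset) * #|` F|%:R.
Proof.
move=> sX cU; rewrite !dim_coverE.
apply: (@le_linear R G (fun F => dim_cover_rel R (fun=> tt) (iter_cover act U F))).
- exact: dim_iter_fset0.
- by move=> ? ?; exact: dim_iter_mono.
- by move=> ? ?; exact: dim_iter_subadd.
- by move=> A c; exact: (@dim_iter_translate _ _ _ _ act (fun _ _ => tt)).
Qed.

Lemma cvg_dim_cover_rel (R : realType) (G : groupType) (X : topologicalType)
    (Y : Type) (actX : G -> X -> X) (actY : G -> Y -> Y) (pi : X -> Y)
    (U : set (set X)) :
  amenable R G -> dynamical_system R actX ->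
  (forall g x, pi (actX g x) = actY g (pi x)) -> finite_open_cover U ->
  exists l : R, dim_cover_rel R pi (iter_cover actX U F) / (#|` F|%fset)%:R
    @[F --> folner_filter R G] --> l.
Proof.
move=> amG sX epi cU.
apply: (@ornstein_weiss R G (fun F => dim_cover_rel R pi (iter_cover actX U F))).
- exact: dim_iter_fset0.
- by move=> F; exact: dim_iter_ge0.
- by move=> F F'; exact: dim_iter_mono.
- by move=> F F'; exact: dim_iter_subadd.
- by move=> F c; exact: (dim_iter_translate sX epi).
- exact: amG.
Qed.

Lemma cvg_dim_cover (R : realType) (G : groupType) (X : topologicalType)
    (act : G -> X -> X) (U : set (set X)) :
  amenable R G -> dynamical_system R act -> finite_open_cover U ->
  exists l : R, dim_cover R (iter_cover act U F) / (#|` F|%fset)%:R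
    @[F --> folner_filter R G] --> l.
Proof.
move=> amG sX cU.
have [l hl] := @cvg_dim_cover_rel R G X unit act (fun _ _ => tt) (fun=> tt) U amG sX
  (fun _ _ => erefl) cU.
exists l; rewrite (_ : (fun F => _) = (fun F =>
  dim_cover_rel R (fun=> tt) (iter_cover act U F) / (#|` F|%fset)%:R)) //.
by apply/funext => F; rewrite dim_coverE.
Qed.

(* Each tile T carries a cover [W T] of X of small order and a cover [V T] of Y
   which together refine [U^T]; the covers of Y are pooled into one cover whose
   iterate over F contributes the mean dimension of Y. *)
Lemma dim_iter_tiled (R : realType) (G : groupType) (X Y : topologicalType)
    (actX : G -> X -> X) (actY : G -> Y -> Y) (pi : X -> Y)
    (U : set (set X)) (a : R) (ts : seq {fset G}) (e : R) :
  dynamical_system R actX -> dynamical_system R actY ->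
  factor_map actX actY pi -> finite_open_cover U -> 0 < e ->
  (forall T, T \in ts ->
    dim_cover_rel R pi (iter_cover actX U T) <= a * #|` T|%:R) ->
  fset0 \notin ts ->
  exists2 V : set (set Y), finite_open_cover V &
    forall F (l : seq ({fset G} * G)),
    (forall p, p \in l -> p.1 \in ts /\ p.2 \in F) ->
    dim_cover R (iter_cover actX U F) <=
      dim_cover R (iter_cover actY V F) +
      (a + e) * (\sum_(p <- l) #|` p.1|)%:R +
      dim_cover R (iter_cover actX U (F `\` tiled l)%fset).
Proof.
move=> sX sY fpi.
have [X0 cX mX actX1 actXM contX] := sX.
have [Y0 cY mY actY1 actYM contY] := sY.
have [cpi epi spi] := fpi.
move=> cU e0 tsa ts0.
have cUi T : finite_open_cover (iter_cover actX U T) by exact: finite_open_cover_iter.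
have /choice[WV HWV] : forall T, exists WV : set (set X) * set (set Y), T \in ts ->
    [/\ finite_open_cover WV.1, finite_open_cover WV.2,
      ord_cover R WV.1 <= (a + e) * #|` T|%:R &
      refines (join_fam (pullback pi WV.2) WV.1) (iter_cover actX U T)].
  move=> T; have [Tts|Tts] := boolP (T \in ts); last by exists (set0, set0).
  have [W0 [cW0 W0U lt0]] := dim_cover_rel_approx pi X0 (cUi T) e0.
  have oU : iter_cover actX U T `<=` open by case: (cUi T).
  have [W [V [cW cV leW ref]]] := relative_refinement X0 cX mX Y0 cY mY cpi oU cW0 W0U.
  exists (W, V) => _; split=> //=; apply: le_trans leW _; apply: le_trans (ltW lt0) _.
  (* The additive error e of the approximate infimum is absorbed in e |T|, since a tile has at least
     one element. *)
  rewrite mulrDl; apply: lerD; first exact: tsa.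
  apply: ler_peMr; [exact: ltW|rewrite ler1n cardfs_gt0].
  by apply: contra ts0 => /eqP <-.
pose V := \big[@join_fam Y/[set [set: Y]]]_(T <- ts) (WV T).2.
have cV : finite_open_cover V.
  by apply: finite_open_cover_bigjoin => T /HWV[].
have Vref T : T \in ts -> refines V (WV T).2.
  move=> Tts; exact: ((refines_bigjoinP ts _ V).1 (@refines_refl _ V) T Tts).
exists V => // F l lP.
pose Z l' := \big[@join_fam X/[set [set: X]]]_(p <- l') pullback (actX p.2) (WV p.1).1.
have cp p : p \in l -> finite_open_cover (pullback (actX p.2) (WV p.1).1).
  by move=> /lP[/HWV[cW _ _ _] _]; exact: finite_open_cover_pullback.
have cZ l' : {subset l' <= l} -> finite_open_cover (Z l').
  by move=> l'l; apply: finite_open_cover_bigjoin => p /l'l/cp.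
have cVi : finite_open_cover (iter_cover actY V F) by exact: finite_open_cover_iter.
have cpVi := finite_open_cover_pullback cpi cVi.
have cU' := cUi (F `\` tiled l)%fset.
have leZ : forall l', {subset l' <= l} ->
    dim_cover R (Z l') <= (a + e) * (\sum_(p <- l') #|` p.1|)%:R.
  elim=> [_|p l' IH l'l].
    rewrite /Z !big_nil mulr0 dim_coverE.
    apply: (@le_trans _ _ (ord_cover R [set [set: X]])).
      by apply: dim_cover_rel_le => //; [exact: finite_open_coverT|exact: refinesT].
    apply: (@ord_cover_le R X _ 0%N) => // x.
    by apply: leq_trans (count_size _ _) _; rewrite fset_set1 cardfs1.
  have pl : p \in l by apply: l'l; exact: mem_head.
  have {}l'l : {subset l' <= l} by move=> q ql; apply: l'l; rewrite inE ql orbT.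
  rewrite /Z !big_cons -/(Z l') natrD mulrDr dim_coverE.
  apply: le_trans (dim_cover_rel_join _ X0 mX (cp _ pl) (cZ _ l'l)) _.
  rewrite -!dim_coverE; apply: lerD; last exact: IH.
  have [/HWV[cW _ leW _] _] := lP _ pl; apply: le_trans leW.
  apply: le_trans (ord_cover_pullback_le R (actX p.2) X0 cW).
  rewrite dim_coverE; apply: dim_cover_rel_le; [exact: X0|exact: cp|].
  exact: refines_joinr.
rewrite -addrA; apply: le_trans (lerD (dim_cover_pullback_le R X0 cpi cVi)
  (lerD (leZ l (fun _ h => h)) (lexx _))).
rewrite !dim_coverE.
have cZU := finite_open_cover_join (cZ l (fun _ h => h)) cU'.
apply: le_trans (lerD (lexx _) (dim_cover_rel_join _ X0 mX (cZ l (fun _ h => h)) cU')).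
apply: le_trans (dim_cover_rel_join _ X0 mX cpVi cZU).
apply: dim_cover_rel_mono => //; first exact: finite_open_cover_join.
set J := join_fam _ _.
have JV : refines J (pullback pi (iter_cover actY V F)) by exact: refines_joinl.
have JZU : refines J (join_fam (Z l) (iter_cover actX U (F `\` tiled l)%fset)).
  exact: refines_joinr.
have [JZ JU] := (refines_joinP _ _ _).1 JZU.
apply/(refines_iter_coverP actX1 actXM) => s sF.
have [stl|stl] := boolP (s \in tiled l); last first.
  apply: refines_trans JU _.
  apply: ((refines_iter_coverP actX1 actXM _ U _).1 (@refines_refl _ _) s).
  by rewrite in_fsetD stl.
have [p /andP[pl _]] := bigfcupP _ _ _ _ stl.
have [pts pF] := lP _ pl; have [cW cV' _ ref] := HWV _ pts.
rewrite in_left_translate => kT.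
have JW : refines J (pullback (actX p.2) (WV p.1).1).
  by apply: refines_trans JZ _;
    exact: ((refines_bigjoinP l _ _).1 (@refines_refl _ _) p pl).
(* The center [p.2] lies in [F], so the iterate of [V] over [F] refines its pullback by [actY p.2];
   equivariance carries this to [X]. *)
have JVp : refines J (pullback (actX p.2) (pullback pi (WV p.1).2)).
  apply: refines_trans JV _; rewrite pullback_comp.
  have -> : pi \o actX p.2 = actY p.2 \o pi by apply/funext => x /=; rewrite epi.
  rewrite -pullback_comp; apply: refines_pullback.
  apply: refines_trans _ (refines_pullback (actY p.2) (Vref _ pts)).
  exact: ((refines_iter_coverP actY1 actYM _ V F).1 (@refines_refl _ _) _ pF).
have : refines J (join_fam (pullback (actX p.2) (pullback pi (WV p.1).2))
    (pullback (actX p.2) (WV p.1).1)) by apply/refines_joinP.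
move=> /refines_trans; apply; apply: refines_trans (@refines_pullback_join _ _ _ _ _) _.
apply: refines_trans (refines_pullback (actX p.2) ref) _.
have := (refines_iter_coverP actX1 actXM _ U p.1).1 (@refines_refl _ _) _ kT.
move=> /(refines_pullback (actX p.2))/refines_trans; apply.
(* For s in the tile, s = (s c^-1) c with s c^-1 in the shape: the refinement for the shape, pulled
   back by c, handles s. *)
rewrite pullback_comp; have -> : actX (s * p.2^-1)%g \o actX p.2 = actX s.
  by apply/funext => x /=; rewrite -actXM mulgVK.
exact: refines_refl.
Qed.

(** All three limits exist, and [V] is fixed before [F]. A single [F], invariant enough to be
    quasi-tiled and close to the limits for [U] and [V], then yields the inequality. *)
Lemma lim_dim_cover_le (R : realType) (G : groupType) (X Y : topologicalType)
    (actX : G -> X -> X) (actY : G -> Y -> Y) (pi : X -> Y) (U : set (set X))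
    (e : R) :
  amenable R G -> dynamical_system R actX -> dynamical_system R actY ->
  factor_map actX actY pi -> finite_open_cover U -> 0 < e ->
  exists2 V : set (set Y), finite_open_cover V &
    lim (dim_cover R (iter_cover actX U F) / (#|` F|%fset)%:R
           @[F --> folner_filter R G]) <=
    lim (dim_cover R (iter_cover actY V F) / (#|` F|%fset)%:R
           @[F --> folner_filter R G]) +
    lim (dim_cover_rel R pi (iter_cover actX U F) / (#|` F|%fset)%:R
           @[F --> folner_filter R G]) + e.
Proof.
move=> amG sX sY fpi cU e0; have PF := folner_filter_proper amG.
have [cpi epi _] := fpi.
have [lr cr] := cvg_dim_cover_rel amG sX epi cU.
have [lX cX] := cvg_dim_cover amG sX cU.
(* Five errors: one for each of the two limits evaluated at F, one in [a], one from
   [dim_iter_tiled], and one for the repeated and uncovered parts of the quasi-tiling. *)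
pose e1 := e / 5; have e10 : 0 < e1 by rewrite divr_gt0.
pose a := lr + e1.
have Fpos (K : {fset G}) (d : R) F : folner_set K d F -> 0 < #|` F|%:R :> R.
  by case=> F0 _; rewrite ltr0n cardfs_gt0.
have one0 : [fset 1%g : G]%fset != fset0 by apply/fset0Pn; exists 1%g; rewrite in_fset1.
have npos : \forall F \near folner_filter R G, 0 < #|` F|%:R :> R.
  by exists ([fset 1%g]%fset, 1) => // F /Fpos.
pose P := [set F | dim_cover_rel R pi (iter_cover actX U F) <= a * #|` F|%:R].
have nP : \forall F \near folner_filter R G, P F.
  have /cvgrPdist_lt/(_ _ e10) := cr; apply: filterS2 npos => F F0.
  by rewrite ltr_norml => /andP[h _]; rewrite /P /= -ler_pdivrMr // /a; lra.
have freq := near_folner_frequently amG nP.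
have a0 : 0 <= a.
  have [F Ff PF'] := freq _ _ one0 ltr01.
  rewrite -(pmulr_lge0 _ (Fpos _ _ _ Ff)); apply: le_trans PF'.
  exact: dim_iter_ge0.
pose M := dim_cover R (iter_cover actX U [fset 1%g]%fset).
have M0 : 0 <= M by rewrite /M dim_coverE; exact: dim_iter_ge0.
pose d := Num.min 2^-1 (e1 / (2 * (a + e1) + M + 1)).
have pos : 0 < 2 * (a + e1) + M + 1 by lra.
have d0 : 0 < d by rewrite lt_min invr_gt0 ltr0n divr_gt0.
have dhalf : d <= 2^-1 by rewrite ge_min lexx.
have de1 : d * (2 * (a + e1) + M + 1) <= e1 by rewrite -ler_pdivlMr // ge_min lexx orbT.
have [ts [K [d' [tsP K0 d'0 til]]]] := quasi_tiling freq d0 dhalf.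
have [||V cV tV] := @dim_iter_tiled R G X Y actX actY pi U a ts e1 sX sY fpi cU e10.
- by move=> T /tsP[].
- by apply/negP => /tsP[_]; rewrite eqxx.
have [lY cY] := cvg_dim_cover amG sY cV.
exists V => //.
rewrite (cvg_lim (@Rhausdorff R) cX) (cvg_lim (@Rhausdorff R) cY).
rewrite (cvg_lim (@Rhausdorff R) cr).
have nF : \forall F \near folner_filter R G, folner_set K d' F by exists (K, d').
have /cvgrPdist_lt/(_ _ e10) nX := cX; have /cvgrPdist_lt/(_ _ e10) nY := cY.
have [F [Ff [hX hY]]] := filter_ex (filterI nF (filterI nX nY)).
have F0 := Fpos _ _ _ Ff; have [l [lP lle lrest]] := til F Ff.
have h1 := tV F l (fun p pl => let: And3 p1 p2 _ := lP p pl in conj p1 p2).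
have h2 := @dim_iter_linear R G X actX U (F `\` tiled l)%fset sX cU.
rewrite -/M in h2.
have h3 := ler_wpM2l M0 lrest.
have ae : 0 <= a + e1 by lra.
have h4 := ler_wpM2l ae lle.
have h5 : 0 <= (e1 - d * (2 * (a + e1) + M + 1)) * #|` F|%:R.
  by rewrite mulr_ge0 // subr_ge0.
have h6 : 0 <= d * #|` F|%:R by rewrite mulr_ge0 // ltW.
have : dim_cover R (iter_cover actX U F) <=
    dim_cover R (iter_cover actY V F) + (a + 2 * e1) * #|` F|%:R by lra.
rewrite -(ler_pM2r (x := (#|` F|%:R)^-1)) ?invr_gt0 // mulrDl mulfK ?gt_eqF // => h.
move: hX hY; rewrite !ltr_norml => /andP[_ hX] /andP[hY _].
by rewrite /a /e1 in h hX hY *; lra.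
Qed.

Theorem theorem1p2 (R : realType) (Gamma : groupType)
    (Gamma_countable : countable [set: Gamma]%classic)
    (Gamma_amenable : amenable R Gamma)
    (X Y : topologicalType) (actX : Gamma -> X -> X) (actY : Gamma -> Y -> Y)
    (X_system : dynamical_system R actX) (Y_system : dynamical_system R actY)
    (pi : X -> Y) (pi_factor : factor_map actX actY pi) :
  (mdim R actX <= mdim R actY + mdim_rel R actX pi)%E.
Proof.
apply: ge_ereal_sup => _ [U cU <-]; apply/lee_addgt0Pr => e e0.
have [V cV le] := lim_dim_cover_le Gamma_amenable X_system Y_system pi_factor cU e0.
apply: le_trans (_ : _ <= (_ + _ + _)%:E)%E _; first by rewrite lee_fin; exact: le.
rewrite !EFinD; apply: leeD => //; apply: leeD.
  by apply: ereal_sup_ubound; exists V.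
by apply: ereal_sup_ubound; exists U.
Qed.
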